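(* Let $R$ be a ring that is semilocal, right hypersimple, and essentially right duo, and suppose that the injective hull $E(R_R)$ is a cyclic right $R$-module. Then $R$ is right pseudo-Frobenius. In particular, $R$ satisfies the following conditions: (1) $J(R)=Z(R_R)=Z({}_RR)$. (2) $\mathrm{soc}(R_R)=\mathrm{soc}({}_RR)$ (denote this common ideal by $\mathrm{soc}(R)$). (3) $\mathrm{soc}(R)$ is essential in $R_R$ and essential in ${}_RR$. (4) For every local idempotent $e$ of $R$, $\mathrm{soc}(eR)$ and $\mathrm{soc}(Re)$ are simple, $\mathrm{soc}(eR)$ is essential in $eR$ (as right modules), and $\mathrm{soc}(Re)$ is essential in $Re$ (as left modules). (5) $R$ has finite left Goldie dimension and finite right Goldie dimension. (6) Every simple right $R$-module embeds in $R_R$ and every simple left $R$-module embeds in ${}_RR$. (7) $R$ is a right $q$-ring. (8) $T=r_R(l_R(T))$ for every right ideal $T$ of $R$.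
   Context: Rings are associative with unity and modules are unitary. $E(M)$ is the injective hull of $M$, $J(R)$ the Jacobson radical, $\mathrm{soc}$ the socle, $Z(R_R)$ and $Z({}_RR)$ the right and left singular ideals; $r_R(X)$ and $l_R(X)$ are the right and left annihilators of $X$ in $R$. $R$ is semilocal if $R/J(R)$ is semisimple Artinian. $R$ is right hypersimple if $E(S)$ is cyclic for every simple right $R$-module $S$. $R$ is essentially right duo if every essential right ideal of $R$ is a two-sided ideal. $R$ is right pseudo-Frobenius if $R_R$ is an injective cogenerator in the category of right $R$-modules; equivalently, $R$ is a semiperfect right self-injective ring with essential right socle. An idempotent $e$ is local if $eRe$ is a local ring. $R$ is a right $q$-ring if every right ideal of $R$ is a quasi-injective right $R$-module. *)

(* Defs.v *)
From HB Require Import structures.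
From mathcomp Require Import all_boot all_order all_algebra.
From mathcomp Require Import boolp.

Set Implicit Arguments.
Unset Strict Implicit.
Unset Printing Implicit Defensive.

Import GRing.Theory.
Local Open Scope ring_scope.
Local Open Scope quotient_scope.

(* MathComp's [lmodType A] is the type of left A-modules.  All notions below
   are defined for left modules over an arbitrary ring A; a right R-module is a
   left module over the converse ring R^c, with x r := (r : conv_ring R) *: x.
   Submodules are the library's [submodClosed V] (boolean predicates, which
   under the classical axioms are arbitrary subsets; closure under opposites
   follows from scaling by -1).  Rings are [pzRingType],
   so the zero ring is not excluded. *)

Definition conv_ring (R : pzRingType) : pzRingType :=
  GRing.PzRing.clone R^c _.

Notation rmodType R := (lmodType (conv_ring R)).

Definition left_reg (R : pzRingType) : lmodType R :=
  GRing.Lmodule.clone R R^o _.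
Definition right_reg (R : pzRingType) : rmodType R := left_reg (conv_ring R).

(** * Submodules as modules *)

Section SubmoduleType.
Variables (A : pzRingType) (V : lmodType A) (U : submodClosed V).

Fact submodB (x y : V) : x \in U -> y \in U -> x - y \in U.
Proof.
by move=> xU yU; rewrite -[- y]scaleN1r; apply: rpredD => //; apply: rpredZ.
Qed.

Definition submod_type : Type := {x : V | x \in U}.

HB.instance Definition _ := SubChoice.on submod_type.
HB.instance Definition _ := [SubChoice_isSubLmodule of submod_type by <:].

Definition submod : lmodType A := GRing.Lmodule.clone A submod_type _.

End SubmoduleType.

(* The submodule of V with a given closed set of elements. *)
Section MkSubmod.
Variables (A : pzRingType) (V : lmodType A) (P : V -> Prop).

Definition submod_axiom : Prop :=
  [/\ P 0, forall x y, P x -> P y -> P (x + y)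
    & forall (a : A) x, P x -> P (a *: x)].

Hypothesis PS : submod_axiom.

Fact mk_submod_subproof : GRing.subsemimod_closed (fun x : V => `[< P x >]).
Proof.
case: PS => P0 PD PZ; split; first split; first exact/asboolP.
  by move=> x y /asboolP Px /asboolP Py; apply/asboolP/PD.
by move=> a x /asboolP Px; apply/asboolP/PZ.
Qed.

Definition mk_submod : submodClosed V :=
  HB.pack (fun x : V => `[< P x >])
    (GRing.isSubmodClosed.Build A V (fun x : V => `[< P x >])
       mk_submod_subproof).

Lemma mk_submodP (x : V) : reflect (P x) (x \in mk_submod).
Proof. exact: asboolP. Qed.

End MkSubmod.

(** * Properties of modules *)

Section Modules.
Variable A : pzRingType.
Implicit Types V W M N E : lmodType A.

Definition simple_mod V : Prop :=
  (exists x : V, x != 0) /\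
  forall U : submodClosed V,
    (forall x, x \in U -> x = 0) \/ (forall x, x \in U).

Definition cyclic_mod V : Prop :=
  exists x : V, forall y : V, exists a : A, y = a *: x.

Definition injective_mod E : Prop :=
  forall M N (i : {linear M -> N}) (f : {linear M -> E}), injective i ->
  exists g : {linear N -> E}, forall x, g (i x) = f x.

Definition quasi_injective_mod V : Prop :=
  forall (U : submodClosed V) (f : {linear submod U -> V}),
  exists g : {linear V -> V}, forall x : submod U, g (val x) = f x.

Definition cogenerator_mod (C : lmodType A) : Prop :=
  forall M N (f g : {linear M -> N}), ~ f =1 g ->
  exists h : {linear N -> C}, ~ h \o f =1 h \o g.

Definition embeds V W : Prop := exists i : {linear V -> W}, injective i.

Definition essential V (U : submodClosed V) : Prop :=
  forall W : submodClosed V,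
    (forall x, x \in U -> x \in W -> x = 0) -> forall x, x \in W -> x = 0.

Definition artinian_mod V : Prop :=
  forall U : nat -> submodClosed V,
    (forall n, {subset U n.+1 <= U n}) ->
    exists n, forall m, (n <= m)%N -> U m =i U n.

Fact lin_image_subproof V W (f : {linear V -> W}) :
  submod_axiom (fun y => exists x, y = f x).
Proof.
split; first by exists 0; rewrite raddf0.
  by move=> x y [u ->] [v ->]; exists (u + v); rewrite raddfD.
by move=> a x [u ->]; exists (a *: u); rewrite linearZ.
Qed.

Definition lin_image V W (f : {linear V -> W}) : submodClosed W :=
  mk_submod (lin_image_subproof f).

Definition injective_hull V E : Prop :=
  exists i : {linear V -> E},
    [/\ injective i, injective_mod E & essential (lin_image i)].

(* E(V), which is unique up to isomorphism, is cyclic. *)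
Definition cyclic_hull V : Prop :=
  exists E, injective_hull V E /\ cyclic_mod E.

Fact cyclic_sub_subproof V (x : V) :
  submod_axiom (fun y : V => exists a : A, y = a *: x).
Proof.
split; first by exists 0; rewrite scale0r.
  by move=> y z [a ->] [b ->]; exists (a + b); rewrite scalerDl.
by move=> a y [b ->]; exists (a * b); rewrite scalerA.
Qed.

Definition cyclic_sub V (x : V) : submodClosed V :=
  mk_submod (cyclic_sub_subproof x).

(* The socle is the sum of the simple submodules. *)
Definition in_simple_sub V (x : V) : Prop :=
  exists2 S : submodClosed V, simple_mod (submod S) & x \in S.

Fact socle_subproof V :
  submod_axiom (fun x : V =>
    exists2 s : seq V, (forall y, y \in s -> in_simple_sub y) &
                       x = \sum_(y <- s) y).
Proof.
split; first by exists [::]; rewrite // big_nil.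
- move=> x y [s Hs ->] [t Ht ->]; exists (s ++ t); last by rewrite big_cat.
  by move=> z; rewrite mem_cat => /orP[/Hs|/Ht].
- move=> a x [s Hs ->]; exists [seq a *: y | y <- s].
    by move=> z /mapP[y /Hs[S simS yS] ->]; exists S => //; apply: rpredZ.
  by rewrite big_map scaler_sumr.
Qed.

Definition socle V : submodClosed V := mk_submod (@socle_subproof V).

Definition semisimple_mod V : Prop := forall x : V, x \in socle V.

Fact ann_subproof V (x : V) :
  submod_axiom (fun a : left_reg A => (a : A) *: x = 0).
Proof.
split; first exact: scale0r.
  by move=> a b a0 b0; rewrite scalerDl a0 b0 addr0.
move=> c a a0; change (((c : A) * (a : A)) *: x = 0).
by rewrite -scalerA a0 scaler0.
Qed.

Definition ann V (x : V) : submodClosed (left_reg A) :=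
  mk_submod (ann_subproof x).

Definition singular_mem V (x : V) : Prop := essential (ann x).

(* V contains no infinite direct sum of nonzero submodules. *)
Definition finite_goldie V : Prop :=
  ~ exists U : nat -> submodClosed V,
      (forall n, exists2 x, x \in U n & x != 0) /\
      (forall (n : nat) (x : nat -> V), (forall i, x i \in U i) ->
         \sum_(i < n) x i = 0 -> forall i, (i < n)%N -> x i = 0).

Definition maximal_sub V (M : submodClosed V) : Prop :=
  (exists x, x \notin M) /\
  forall U : submodClosed V, {subset M <= U} ->
    U =i M \/ (forall x, x \in U).

End Modules.

(** * Rings *)

(* There is exactly one maximal right ideal. *)
Definition local_ring (R : pzRingType) : Prop :=
  exists2 M : submodClosed (right_reg R), maximal_sub M &
    forall M' : submodClosed (right_reg R), maximal_sub M' -> M' =i M.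

Definition semisimple_artinian (R : pzRingType) : Prop :=
  semisimple_mod (right_reg R) /\ artinian_mod (right_reg R).

Section Jacobson.
Variable R : pzRingType.
Implicit Types x y r : R.

Definition jacobson : R -> bool := fun x =>
  `[< forall M : submodClosed (right_reg R), maximal_sub M ->
        (x : right_reg R) \in M >].

Fact jacobson_zmod_closed : zmod_closed jacobson.
Proof.
split; first by apply/asboolP => M _; apply: rpred0.
move=> x y /asboolP xJ /asboolP yJ; apply/asboolP => M maxM.
exact: submodB (xJ M maxM) (yJ M maxM).
Qed.

HB.instance Definition _ := GRing.isZmodClosed.Build R jacobson
  jacobson_zmod_closed.

Fact jacobsonMr x r : x \in jacobson -> x * r \in jacobson.
Proof.
move=> /asboolP xJ; apply/asboolP => M maxM.
change ((r : conv_ring R) *: (x : right_reg R) \in M).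
exact/rpredZ/xJ.
Qed.

(* For a maximal right ideal M, the right ideal {y | r y \in M} is R or
   maximal; hence J(R) is a left ideal too. *)
Fact colon_subproof r (M : submodClosed (right_reg R)) :
  submod_axiom (fun y : right_reg R => ((r * y : R) : right_reg R) \in M).
Proof.
split; first by rewrite mulr0 rpred0.
  by move=> x y xM yM; rewrite mulrDr; apply: rpredD.
move=> a x xM.
change ((r * ((x : R) * (a : R)) : R) \in M); rewrite mulrA.
change (a *: (r * (x : R) : right_reg R) \in M); exact: rpredZ.
Qed.

Let colon r M := mk_submod (colon_subproof r M).

Fact jacobsonMl x r : x \in jacobson -> r * x \in jacobson.
Proof.
move=> /asboolP xJ; apply/asboolP => M [[z zM] maxM].
case: (pselect (forall y : right_reg R, y \in colon r M)) => [all|nall].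
  by have /mk_submodP := all x.
suff /mk_submodP : (x : right_reg R) \in colon r M by [].
apply: xJ; split; first by move/existsNP: nall => [y /negP yM]; exists y.
move=> U subU.
case: (pselect (forall u, u \in U -> u \in colon r M)) => [UM|nUM].
  by left=> u; apply/idP/idP => [/UM|/subU].
right=> w; move/existsNP: nUM => [u /not_implyP[uU uM]].
pose ru : right_reg R := (r * (u : R) : R).
have clP : submod_axiom (fun v : right_reg R =>
    exists m (a : conv_ring R), m \in M /\ v = m + a *: ru).
  split.
  - by exists 0, 0; rewrite rpred0 scale0r addr0.
  - move=> v1 v2 [m1 [a1 [m1M ->]]] [m2 [a2 [m2M ->]]].
    exists (m1 + m2), (a1 + a2); split; first exact: rpredD.
    by rewrite scalerDl addrACA.
  - move=> b v [m [a [mM ->]]].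
    exists (b *: m), (b * a); split; first exact: rpredZ.
    by rewrite scalerDr scalerA.
have [|WM|Wall] := maxM (mk_submod clP).
- by move=> m mM; apply/mk_submodP; exists m, 0; rewrite scale0r addr0.
- case: uM; apply/mk_submodP; change (ru \in M); rewrite -WM; apply/mk_submodP.
  by exists 0, 1; rewrite rpred0 scale1r add0r.
have /mk_submodP[m [a [mM Em]]] := Wall (r * (w : R) : R).
have wU : w - a *: u \in U.
  apply/subU/mk_submodP.
  suff -> : r * ((w : R) - (u : R) * (a : R)) = m by [].
  by rewrite mulrBr mulrA; apply/eqP; rewrite subr_eq; apply/eqP.
have : w - a *: u + a *: u \in U by apply: rpredD wU _; apply: rpredZ.
by rewrite subrK.
Qed.

End Jacobson.

Section JacobsonQuotient.
Variable R : pzRingType.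
Implicit Types x y r : R.

Definition jacobson_closed : zmodClosed R :=
  GRing.ZmodClosed.clone R (@jacobson R) _.

(* The library only makes quotients of commutative rings into rings. *)
Definition jacobson_quot : Type := {ideal_quot jacobson_closed}.

HB.instance Definition _ := GRing.Zmodule.on jacobson_quot.
HB.instance Definition _ := EqQuotient.on jacobson_quot.

Local Notation Q := jacobson_quot.

Definition jq_one : Q := \pi_Q 1.
Definition jq_mul (x y : Q) : Q := \pi_Q (repr x * repr y).

Fact jq_eqP x y : reflect (\pi_Q x = \pi_Q y) (x - y \in @jacobson R).
Proof. by rewrite Quotient.idealrBE; apply: eqP. Qed.

Fact jq_mulE x y : jq_mul (\pi_Q x) (\pi_Q y) = \pi_Q (x * y).
Proof.
apply/jq_eqP; set x' := repr _; set y' := repr _.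
have xJ : x' - x \in @jacobson R by apply/jq_eqP; rewrite reprK.
have yJ : y' - y \in @jacobson R by apply/jq_eqP; rewrite reprK.
have -> : x' * y' - x * y = (x' - x) * y' + x * (y' - y).
  by rewrite mulrBl mulrBr addrA subrK.
by apply: rpredD; [apply: jacobsonMr | apply: jacobsonMl].
Qed.

Fact jq_addE x y : \pi_Q x + \pi_Q y = \pi_Q (x + y).
Proof. exact/esym/Quotient.pi_add. Qed.

Fact jq_mulA : associative jq_mul.
Proof.
elim/quotW=> x; elim/quotW=> y; elim/quotW=> z.
by rewrite (jq_mulE y z) (jq_mulE x y) (jq_mulE x (y * z)) jq_mulE mulrA.
Qed.

Fact jq_mul1 : left_id jq_one jq_mul.
Proof. by elim/quotW=> x; rewrite jq_mulE mul1r. Qed.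

Fact jq_mulr1 : right_id jq_one jq_mul.
Proof. by elim/quotW=> x; rewrite jq_mulE mulr1. Qed.

Fact jq_mulDl : left_distributive jq_mul +%R.
Proof.
elim/quotW=> x; elim/quotW=> y; elim/quotW=> z.
by rewrite jq_addE (jq_mulE x z) (jq_mulE y z) jq_mulE jq_addE mulrDl.
Qed.

Fact jq_mulDr : right_distributive jq_mul +%R.
Proof.
elim/quotW=> x; elim/quotW=> y; elim/quotW=> z.
by rewrite jq_addE (jq_mulE x y) (jq_mulE x z) jq_mulE jq_addE mulrDr.
Qed.

HB.instance Definition _ := GRing.Zmodule_isPzRing.Build jacobson_quot
  jq_mulA jq_mul1 jq_mulr1 jq_mulDl jq_mulDr.

Definition jacobson_quot_ring : pzRingType :=
  GRing.PzRing.clone jacobson_quot _.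

End JacobsonQuotient.

(** The corner ring e R e of an idempotent e, with unity e. *)

Record idem_elt (R : pzRingType) := Idempotent {
  idem_val :> R;
  idem_mul : idem_val * idem_val = idem_val
}.

Section Corner.
Variables (R : pzRingType) (e : idem_elt R).

Definition in_corner : R -> bool :=
  fun x => `[< exists r : R, x = (e : R) * r * (e : R) >].

Fact in_corner_zmod_closed : zmod_closed in_corner.
Proof.
split; first by apply/asboolP; exists 0; rewrite mulr0 mul0r.
move=> x y /asboolP[r ->] /asboolP[s ->]; apply/asboolP.
by exists (r - s); rewrite mulrBr mulrBl.
Qed.

HB.instance Definition _ := GRing.isZmodClosed.Build R in_corner
  in_corner_zmod_closed.

Definition corner : Type := {x : R | x \in in_corner}.

HB.instance Definition _ := SubChoice.on corner.
HB.instance Definition _ := [SubChoice_isSubZmodule of corner by <:].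

Fact corner1_subproof : (e : R) \in in_corner.
Proof. by apply/asboolP; exists 1; rewrite mulr1 idem_mul. Qed.

Fact cornerM_subproof (x y : corner) : val x * val y \in in_corner.
Proof.
case: x y => [x xe] [y ye] /=; move/asboolP: xe => [r ->].
move/asboolP: ye => [s ->]; apply/asboolP.
by exists (r * (e : R) * (e : R) * s); rewrite !mulrA.
Qed.

Definition corner1 : corner :=
  exist _ (e : R) corner1_subproof.
Definition cornerM (x y : corner) : corner :=
  exist _ (val x * val y) (cornerM_subproof x y).

Fact cornerA : associative cornerM.
Proof. by move=> x y z; apply: val_inj; rewrite /= mulrA. Qed.

Fact corner1r : left_id corner1 cornerM.
Proof.
move=> x; apply: val_inj => /=; case: x => x /= /asboolP[r ->].
by rewrite !mulrA idem_mul.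
Qed.

Fact cornerr1 : right_id corner1 cornerM.
Proof.
move=> x; apply: val_inj => /=; case: x => x /= /asboolP[r ->].
by rewrite -!mulrA idem_mul.
Qed.

Fact cornerDl : left_distributive cornerM +%R.
Proof. by move=> x y z; apply: val_inj; rewrite /= mulrDl. Qed.

Fact cornerDr : right_distributive cornerM +%R.
Proof. by move=> x y z; apply: val_inj; rewrite /= mulrDr. Qed.

HB.instance Definition _ := GRing.Zmodule_isPzRing.Build corner
  cornerA corner1r cornerr1 cornerDl cornerDr.

Definition corner_ring : pzRingType := GRing.PzRing.clone corner _.

End Corner.

Section RingProperties.
Variable R : pzRingType.
Implicit Types x y r : R.

Definition semilocal : Prop := semisimple_artinian (jacobson_quot_ring R).

Definition right_hypersimple : Prop :=
  forall S : rmodType R, simple_mod S -> cyclic_hull S.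

Definition essentially_right_duo : Prop :=
  forall I : submodClosed (right_reg R), essential I ->
  forall r x, (x : right_reg R) \in I -> ((r * x : R) : right_reg R) \in I.

Definition right_PF : Prop :=
  injective_mod (right_reg R) /\ cogenerator_mod (right_reg R).

Definition right_q_ring : Prop :=
  forall I : submodClosed (right_reg R), quasi_injective_mod (submod I).

Definition local_idempotent (e : idem_elt R) : Prop := local_ring (corner_ring e).

Definition right_ann (X : R -> Prop) : R -> Prop :=
  fun r => forall x, X x -> x * r = 0.
Definition left_ann (X : R -> Prop) : R -> Prop :=
  fun r => forall x, X x -> r * x = 0.

(* The one-sided ideals eR and Re, as modules. *)
Definition eR_mod (e : R) : rmodType R :=
  submod (cyclic_sub (e : right_reg R)).
Definition Re_mod (e : R) : lmodType R :=
  submod (cyclic_sub (e : left_reg R)).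

Fact ann_rightP x r :
  (r : left_reg (conv_ring R)) \in ann (x : right_reg R) <-> x * r = 0.
Proof. by split=> [/mk_submodP|H]; last exact/mk_submodP. Qed.

Fact ann_leftP x r :
  (r : left_reg R) \in ann (x : left_reg R) <-> r * x = 0.
Proof. by split=> [/mk_submodP|H]; last exact/mk_submodP. Qed.

Fact eR_P (e x : R) :
  (x : right_reg R) \in cyclic_sub (e : right_reg R) <->
  exists r : R, x = e * r.
Proof. by split=> [/mk_submodP|H]; last exact/mk_submodP. Qed.

Fact Re_P (e x : R) :
  (x : left_reg R) \in cyclic_sub (e : left_reg R) <->
  exists r : R, x = r * e.
Proof. by split=> [/mk_submodP|H]; last exact/mk_submodP. Qed.

End RingProperties.

(* Main.v *)
Require Import Defs.
From HB Require Import structures.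
From mathcomp Require Import all_boot all_order all_algebra.
From mathcomp Require Import boolp.
From mathcomp Require classical_sets.

(** Write J for J(R).

    Self-injectivity.  Let E(R) = xR with 1 = xa.  The map r |-> x r extends
    to an endomorphism g of E(R), the map r |-> a r to an endomorphism h, and
    g h is the identity on the essential submodule R.  A cyclic module over a
    semilocal ring is Dedekind finite, because chains t^n R stabilise modulo J
    ([cyclic_dedekind_finite]); hence g is injective, r |-> x r is an
    isomorphism from R to E(R), and R is right self-injective.  It follows
    that J is the right singular ideal, that right ideals with zero
    intersection are separated by an idempotent, and, by the chain condition
    modulo J, that 1 is a finite sum of orthogonal local idempotents e_i, with
    every e_i R uniform ([decomposition]).

    The duo condition.  If A is a nonzero submodule of eR, with e local, then
    A + (1 - e)R is an essential right ideal, so it absorbs multiplication on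
    the left, and this says that eR(1 - e) lies in A ([duo_minimal]).  So
    either eR(1 - e) = 0, or eR(1 - e) generates the least nonzero submodule
    of eR, which is simple; call e mixed in the second case.

    Every top S_i = e_i R / e_i J embeds in R.  Suppose first that e = e_i is
    not mixed, and let E(S_i) = xR with annihilator I = ann x.  If I is not
    essential, some nonzero right ideal meets I trivially, embeds in E(S_i) and
    so contains a copy of S_i.  If I is essential, it is an ideal that
    annihilates E(S_i), while any nonzero te in Ie would give a nonzero map
    from teR to E(S_i), of the form te r |-> x b t e r by injectivity, although
    bt is in I; so Ie = 0, and then I cannot meet eR = eRe
    ([unmixed_top_embeds]).  Suppose now that e_i is mixed.  The socle of e_i R
    is isomorphic to some top S_k; the idempotent e_k is mixed again, and S_k
    determines S_i since e_i R is its injective hull.  The assignment i |-> k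
      is thus injective on the finite
    set of isomorphism classes of mixed tops, hence surjective, and every
    mixed top is the socle of some e_i R ([mixed_top_embeds]).

    Consequences.  As all tops embed, {a | aJ = 0} is an essential right ideal
    and is the right socle, and every proper right ideal is annihilated on the
    left by some a with aR simple ([proper_killed]).  With self-injectivity
    this yields the cogenerator property and the double annihilator condition;
    these in turn make aR simple exactly when Ra is, so that left and right
    socle agree, and the remaining assertions are computations with elements
    that generate simple modules. *)

Set Implicit Arguments.
Unset Strict Implicit.
Unset Printing Implicit Defensive.

Import GRing.Theory.
Local Open Scope ring_scope.

(** * Modules over an arbitrary ring *)

Section ModuleGenerality.
Variable A : pzRingType.
Implicit Types V W E : lmodType A.

Lemma linear_of V W (f : V -> W) :
  (forall a x y, f (a *: x + y) = a *: f x + f y) ->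
  exists g : {linear V -> W}, forall x, g x = f x.
Proof.
move=> fP; pose B := GRing.isLinear.Build A V W *:%R f fP.
by exists (HB.pack_for {linear V -> W} f B).
Qed.

(** Linear maps are mostly built from their graphs, given as relations; this
    avoids choosing coefficients of elements over a generator. *)
Definition pairs_submod V W (G : V -> W -> Prop) : Prop :=
  [/\ G 0 0, forall x y x' y', G x y -> G x' y' -> G (x + x') (y + y')
    & forall a x y, G x y -> G (a *: x) (a *: y)].

Lemma linear_of_pairs V W (G : V -> W -> Prop) :
  pairs_submod G -> (forall y, G 0 y -> y = 0) -> (forall x, exists y, G x y) ->
  exists f : {linear V -> W}, forall x y, G x y -> f x = y.
Proof.
move=> [G0 GD GZ] G1 Gtot.
have Guniq x y y' : G x y -> G x y' -> y = y'.
  move=> xy xy'; apply/eqP; rewrite -subr_eq0; apply/eqP/G1.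
  have := GD _ _ _ _ xy (GZ (-1) _ _ xy').
  by rewrite !scaleN1r subrr.
pose f x := projT1 (cid (Gtot x)).
have fG x : G x (f x) by rewrite /f; case: cid.
have [|g gf] := @linear_of V W f.
  move=> a x y; apply: (Guniq (a *: x + y)) (fG _) _.
  by apply: GD (fG _); apply: GZ.
by exists g => x y xy; rewrite gf; apply: Guniq (fG _) xy.
Qed.

(** The usual form of injectivity: a partial linear map, with domain any
    submodule, extends to the whole module. *)
Lemma injective_extend V E (G : V -> E -> Prop) : injective_mod E ->
  pairs_submod G -> (forall y, G 0 y -> y = 0) ->
  exists f : {linear V -> E}, forall x y, G x y -> f x = y.
Proof.
move=> injE [G0 GD GZ] G1.
have domP : submod_axiom (fun x => exists y, G x y).
  split; first by exists 0.
    by move=> x x' [y xy] [y' xy']; exists (y + y'); apply: GD.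
  by move=> a x [y xy]; exists (a *: y); apply: GZ.
pose U := mk_submod domP.
have [|||f fG] := @linear_of_pairs (submod U) E (fun x y => G (val x) y).
- by split=> [|x y x' y'|a x y]; [|apply: GD|apply: GZ].
- by move=> y; apply: G1.
- by move=> x; have /mk_submodP := valP x.
have [g gf] := injE (submod U) V (val : {linear submod U -> V}) f val_inj.
exists g => x y xy; have xU : x \in U by apply/mk_submodP; exists y.
by rewrite -[x]/(val (Sub x xU : submod U)) gf; apply: fG.
Qed.

(** The one application of Zorn's lemma: it gives both maximal right ideals
    (avoid 1) and relative complements (avoid the nonzero elements of a
    submodule). *)
Lemma maximal_avoiding V (U : submodClosed V) (X : V -> Prop) :
  (forall x, x \in U -> ~ X x) ->
  exists C : submodClosed V,
    [/\ {subset U <= C}, forall x, x \in C -> ~ X x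
      & forall D : submodClosed V, {subset C <= D} ->
          (forall x, x \in D -> ~ X x) -> {subset D <= C}].
Proof.
move=> UX.
pose good (B : V -> Prop) := [/\ submod_axiom B, forall x, x \in U -> B x
   & forall x, B x -> ~ X x].
pose P (B : V -> Prop) := (forall x, ~ B x) \/ good B.
have goodU : good (fun x => x \in U).
  split=> //; split=> [|x y|a x]; [exact: rpred0|exact: rpredD|exact: rpredZ].
have [|M [PM maxM]] := @classical_sets.Zorn_bigcup V P.
  move=> F FP totF.
  case: (pselect (exists2 B, F B & exists b, B b)) => [[B FB [b Bb]]|nF];
    last first.
    by left=> x [B FB Bx]; apply: nF; exists B => //; exists x.
  right; have Pgood C c : F C -> C c -> good C.
    by move=> FC Cc; case: (FP C FC) => // /(_ c).
  have [[B0 _ _] UB _] := Pgood _ _ FB Bb.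
  split; first split.
  - by exists B.
  - move=> x y [C FC Cx] [D FD Dy].
    have [[_ CD _] _ _] := Pgood _ _ FC Cx.
    have [[_ DD _] _ _] := Pgood _ _ FD Dy.
    case: (totF C D FC FD) => sub; [exists D|exists C] => //.
      by apply: DD => //; apply: sub.
    by apply: CD => //; apply: sub.
  - move=> a x [C FC Cx]; exists C => //.
    by have [[_ _ CZ] _ _] := Pgood _ _ FC Cx; apply: CZ.
  - by move=> x xU; exists B => //; apply: UB.
  - by move=> x [C FC Cx]; have [_ _] := Pgood _ _ FC Cx; apply.
have {PM} [MS UM MX] : good M.
  case: PM => // M0; case: (maxM _ _ (or_intror goodU)).
  split; first by move=> x /M0.
  by move=> /(_ 0 (rpred0 U)); apply: M0.
exists (mk_submod MS); split.
- by move=> x xU; apply/mk_submodP/UM.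
- by move=> x /mk_submodP; apply: MX.
move=> D MD DX x xD; apply/mk_submodP; apply: contrapT => nMx.
apply: (maxM (fun y => y \in D)).
  split; last by move=> /(_ x xD).
  by move=> y My; apply/MD/mk_submodP.
right; split=> //.
  split=> [|y z|a y]; [exact: rpred0|exact: rpredD|exact: rpredZ].
by move=> y yU; apply/MD/mk_submodP/UM.
Qed.

Lemma maximal_sub_above V (U : submodClosed V) (x : V) :
  (forall y, exists a, y = a *: x) -> x \notin U ->
  exists2 M : submodClosed V, maximal_sub M & {subset U <= M}.
Proof.
move=> gen xU.
have [|M [UM Mx maxM]] := @maximal_avoiding V U (fun y => y = x).
  by move=> y yU /= yx; rewrite -yx yU in xU.
exists M => //; split; first by exists x; apply/negP => /Mx; apply.
move=> D MD; case: (pselect (x \in D)) => [xD|nxD].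
  by right=> y; have [a ->] := gen y; apply: rpredZ.
left=> y; apply/idP/idP => [|/MD //]; apply: maxM => // z zD zx.
by apply: nxD; rewrite -zx.
Qed.

(** Simplicity of the submodule generated by x, said in terms of x alone. *)
Definition simple_elt V (x : V) : Prop :=
  x <> 0 /\ forall a : A, a *: x <> 0 -> exists b : A, b *: (a *: x) = x.

Lemma submodN V (U : submodClosed V) (x : V) : x \in U -> - x \in U.
Proof. by rewrite -scaleN1r; apply: rpredZ. Qed.

Lemma cyclic_subP V (x y : V) : reflect (exists a : A, y = a *: x) (y \in
  cyclic_sub x).
Proof. exact: mk_submodP. Qed.

Lemma cyclic_sub_refl V (x : V) : x \in cyclic_sub x.
Proof. by apply/cyclic_subP; exists 1; rewrite scale1r. Qed.

Lemma simple_gen V (x y : V) : simple_mod V -> x <> 0 ->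
  exists a : A, y = a *: x.
Proof.
move=> [_ /(_ (cyclic_sub x))[z|all]] x0; last exact/cyclic_subP.
by case: x0; apply/z/cyclic_sub_refl.
Qed.

Lemma simple_elt_cyclic_sub V (x : V) : simple_elt x ->
  simple_mod (submod (cyclic_sub x)).
Proof.
move=> [x0 gx]; split.
  exists (Sub x (cyclic_sub_refl x)); apply/eqP => /(congr1 val).
  exact: x0.
move=> U; case: (pselect (forall u, u \in U -> u = 0)) => [|nU]; first by left.
right=> u; move/existsNP: nU => [v /not_implyP[vU v0]].
have /cyclic_subP[a va] := valP v; have /cyclic_subP[b ub] := valP u.
have [|c cx] := gx a.
  by rewrite -va => v0'; apply: v0; apply: val_inj; rewrite v0'.
suff -> : u = (b * c) *: v by apply: rpredZ.
by apply: val_inj; rewrite ub linearZ /= va -scalerA cx.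
Qed.

Lemma simple_elt_of_sub V (S : submodClosed V) (x : V) :
  simple_mod (submod S) -> x \in S -> x <> 0 -> simple_elt x.
Proof.
move=> simS xS x0; split=> // a ax0.
have axS : a *: x \in S by apply: rpredZ.
have [|b] := @simple_gen _ (Sub (a *: x) axS : submod S) (Sub x xS) simS.
  by move/(congr1 val); apply: ax0.
by move/(congr1 val) => xE; exists b; apply: esym xE.
Qed.

Lemma socleP V (x : V) :
  x \in socle V <->
  exists2 s : seq V, (forall y, y \in s -> simple_elt y) & x = \sum_(y <- s) y.
Proof.
split=> [/mk_submodP[s sP ->]|[s sP ->]]; last first.
  apply/mk_submodP; exists s => // y /sP gy.
  by exists (cyclic_sub y);
    [apply: simple_elt_cyclic_sub|apply: cyclic_sub_refl].
exists [seq y <- s | y != 0].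
  move=> y; rewrite mem_filter => /andP[/eqP y0 /sP[S simS yS]].
  exact: simple_elt_of_sub simS yS y0.
rewrite big_filter; elim: s {sP} => [|y s IH]; first by rewrite !big_nil.
by rewrite !big_cons IH; case: eqP => // ->; rewrite add0r.
Qed.

Lemma simple_elt_socle V (x : V) : simple_elt x -> x \in socle V.
Proof.
move=> gx; apply/socleP; exists [:: x]; last by rewrite big_seq1.
by move=> y; rewrite inE => /eqP ->.
Qed.

Lemma simple_elt_submod V (U : submodClosed V) (x : submod U) :
  simple_elt x <-> simple_elt (val x).
Proof.
have v0 (y : submod U) : y <> 0 <-> val y <> 0.
  by split=> y0 yE; apply: y0; [apply: val_inj|]; rewrite yE.
split=> [[/v0 x0 gx]|[/v0 x0 gx]]; split=> // a ax.
  have [|b bx] := gx a; first by apply/v0; rewrite linearZ.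
  by exists b; rewrite -[in RHS]bx !linearZ.
have [|b bx] := gx a; first by move/v0: ax; rewrite linearZ.
by exists b; apply: val_inj; rewrite !linearZ.
Qed.

Lemma essential_of V (U : submodClosed V) :
  (forall x, x <> 0 -> exists a : A, a *: x <> 0 /\ a *: x \in U) ->
    essential U.
Proof.
move=> UP W UW x xW; apply: contrapT => /UP[a [ax axU]].
by apply/ax/UW => //; apply: rpredZ.
Qed.

Lemma essentialE V (U : submodClosed V) (x : V) : essential U -> x <> 0 ->
  exists a : A, a *: x <> 0 /\ a *: x \in U.
Proof.
move=> essU x0; apply: contrapT => nex; apply: x0.
apply: (essU (cyclic_sub x)) (cyclic_sub_refl x) => y yU /cyclic_subP[a ya].
by apply: contrapT => y0; apply: nex; exists a; rewrite -ya.
Qed.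

(** Equivalent to essentiality of the socle, since a nonzero cyclic submodule
    of the socle contains a simple submodule; it is the form in which essential
    socles are produced and used below. *)
Definition socle_dense V : Prop :=
  forall x : V, x <> 0 -> exists a : A, simple_elt (a *: x).

Lemma essential_socle V : socle_dense V -> essential (socle V).
Proof.
move=> dV; apply: essential_of => x /dV[a ga]; exists a; split.
  by case: ga.
exact: simple_elt_socle.
Qed.

Lemma simple_socle V : socle_dense V -> (exists x : V, x <> 0) ->
  (forall x y : V, simple_elt x -> simple_elt y -> exists a : A, y = a *: x) ->
  simple_mod (submod (socle V)).
Proof.
move=> dV [x x0] lin; have [a gs] := dV x x0;
  move: (a *: x) gs => {a x x0} s gs.
have soc (z : V) : z \in socle V -> exists a, z = a *: s.
  move=> /socleP[t tP ->]; elim: t tP {z} => [|y t IH] tP.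
    by exists 0; rewrite big_nil scale0r.
  have [w wt|b Eb] := IH; first by apply: tP; rewrite inE wt orbT.
  have [|c Ec] := lin s y gs; first by apply: tP; rewrite mem_head.
  by exists (c + b); rewrite big_cons Eb Ec scalerDl.
split.
  exists (Sub s (simple_elt_socle gs)); apply/eqP => /(congr1 val).
  by have [s0 _] := gs; apply: s0.
move=> U; case: (pselect (forall u, u \in U -> u = 0)) => [|nU]; first by left.
right=> u; move/existsNP: nU => [v /not_implyP[vU v0]].
have [b vb] := soc _ (valP v); have [c uc] := soc _ (valP u).
have [_ gs2] := gs; have [|d ds] := gs2 b.
  by rewrite -vb => vE; apply: v0; apply: val_inj; rewrite vE.
suff -> : u = (c * d) *: v by apply: rpredZ.
by apply: val_inj; rewrite uc linearZ /= vb -scalerA ds.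
Qed.

Fact sum_sub_subproof V (U W : submodClosed V) :
  submod_axiom (fun x => exists u w, [/\ u \in U, w \in W & x = u + w]).
Proof.
split; first by exists 0, 0; rewrite !rpred0 addr0.
  move=> x y [u [w [uU wW ->]]] [u' [w' [uU' wW' ->]]].
  by exists (u + u'), (w + w'); rewrite !rpredD // addrACA.
move=> a x [u [w [uU wW ->]]]; exists (a *: u), (a *: w).
by rewrite !rpredZ // scalerDr.
Qed.

Definition sum_sub V (U W : submodClosed V) := mk_submod (sum_sub_subproof U W).

Lemma sum_subP V (U W : submodClosed V) x :
  reflect (exists u w, [/\ u \in U, w \in W & x = u + w]) (x \in sum_sub U W).
Proof. exact: mk_submodP. Qed.

Lemma sum_subl V (U W : submodClosed V) : {subset U <= sum_sub U W}.
Proof. by move=> u uU; apply/sum_subP; exists u, 0; rewrite rpred0 addr0. Qed.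

Lemma sum_subr V (U W : submodClosed V) : {subset W <= sum_sub U W}.
Proof. by move=> w wW; apply/sum_subP; exists 0, w; rewrite rpred0 add0r. Qed.

(** A submodule U has a complement inside the sum of U and finitely many simple
    submodules: add the simple submodules one at a time, skipping those that
    are already contained in what has been built. *)
Lemma complement V (U : submodClosed V) (s : seq V) :
  (forall x, x \in s -> simple_elt x) ->
  exists K : submodClosed V,
    (forall x, x \in U -> x \in K -> x = 0) /\
    (forall x, x \in s -> x \in sum_sub U K).
Proof.
elim: s => [|a s IH] sP.
  have P0 : submod_axiom (fun x : V => x = 0).
    by split=> // [x y -> ->|b x ->]; rewrite ?addr0 ?scaler0.
  by exists (mk_submod P0); split=> // x _ /mk_submodP.
have [x xs|K [UK sK]] := IH; first by apply: sP; rewrite inE xs orbT.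
case: (pselect (a \in sum_sub U K)) => [aUK|aUK].
  by exists K; split=> // x; rewrite inE => /orP[/eqP ->|/sK].
exists (sum_sub K (cyclic_sub a)); split; last first.
  move=> x; rewrite inE => /orP[/eqP ->|/sK /sum_subP[u [k [uU kK ->]]]].
    by apply/sum_subr/sum_subr; apply: cyclic_sub_refl.
  by apply: rpredD; [apply: sum_subl|apply/sum_subr/sum_subl].
move=> x xU /sum_subP[k [z [kK /cyclic_subP[b zE] xE]]].
suff z0 : z = 0 by rewrite z0 addr0 in xE; apply: UK => //; rewrite xE.
apply: contrapT; rewrite zE => ba0; apply: aUK.
have [_ /(_ b ba0)[c <-]] := sP a (mem_head _ _).
apply/rpredZ/sum_subP; exists x, (- k); split=> //; first exact: submodN.
by rewrite -zE xE addrC addKr.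
Qed.

Fact partial_sum_subproof V (U : nat -> submodClosed V) n :
  submod_axiom (fun x : V => exists u : nat -> V,
    (forall i, u i \in U i) /\ x = \sum_(i < n) u i).
Proof.
split.
- by exists (fun=> 0); rewrite big1; split=> // i; apply: rpred0.
- move=> x y [u [uU ->]] [v [vU ->]]; exists (fun i => u i + v i).
  by rewrite big_split; split=> // i; apply: rpredD.
- move=> a x [u [uU ->]]; exists (fun i => a *: u i).
  by rewrite scaler_sumr; split=> // i; apply: rpredZ.
Qed.

Definition partial_sum V (U : nat -> submodClosed V) n :=
  mk_submod (partial_sum_subproof U n).

Lemma partial_sum_mono V (U : nat -> submodClosed V) n m :
  (n <= m)%N -> {subset partial_sum U n <= partial_sum U m}.
Proof.
move=> nm x /mk_submodP[u [uU ->]]; apply/mk_submodP.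
exists (fun i => if (i < n)%N then u i else 0); split.
  by move=> i; case: ifP => // _; apply: rpred0.
by rewrite (big_ord_widen m u nm) -big_mkcond.
Qed.

(** If s generates the socle, then finitely many terms of an independent
    family U_n already absorb it modulo a complement of the sum of the U_n.
    Every later U_n contains a simple submodule, which then lies both in U_n
    and in the sum of the earlier terms. *)
Lemma finite_goldie_of V (s : seq V) : socle_dense V ->
  (forall x, x \in s -> simple_elt x) ->
  (forall x : V, simple_elt x -> forall W : submodClosed V,
     {subset s <= W} -> x \in W) ->
  finite_goldie V.
Proof.
move=> dV sP gen [U [U0 indep]].
have DP : submod_axiom (fun x : V => exists n, x \in partial_sum U n).
  split; first by exists 0%N; apply: rpred0.
    move=> x y [n xn] [m ym]; exists (maxn n m); apply: rpredD.
      exact: partial_sum_mono (leq_maxl n m) _ xn.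
    exact: partial_sum_mono (leq_maxr n m) _ ym.
  by move=> a x [n xn]; exists n; apply: rpredZ.
have [K [DK sK]] := complement (mk_submod DP) sP.
have [n sW] : exists n, {subset s <= sum_sub (partial_sum U n) K}.
  elim: s sK {sP gen} => [|a s IH] sK; first by exists 0%N.
  have [x xs|n sn] := IH; first by apply: sK; rewrite inE xs orbT.
  have /sum_subP[d [k [/mk_submodP[m dm] kK ->]]] := sK a (mem_head _ _).
  exists (maxn n m) => x; rewrite inE => /orP[/eqP ->|/sn /sum_subP].
    apply/sum_subP; exists d, k; split=> //.
    exact: partial_sum_mono (leq_maxr n m) _ dm.
  move=> [d' [k' [d'n k'K ->]]]; apply/sum_subP; exists d', k'; split=> //.
  exact: partial_sum_mono (leq_maxl n m) _ d'n.
have [x xU /eqP x0] := U0 n; have [a gax] := dV x x0.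
have axU : a *: x \in U n by apply: rpredZ.
have /sum_subP[w [k [wW kK axE]]] := gen _ gax _ sW.
have axD : exists m, a *: x \in partial_sum U m.
  exists n.+1; apply/mk_submodP; exists (fun i => if i == n then a *: x else 0).
  split; first by move=> i; case: eqP => [->|_] //; apply: rpred0.
  rewrite big_ord_recr /= eqxx big1 ?add0r // => i _.
  by rewrite (ltn_eqF (ltn_ord i)).
have k0 : k = 0.
  apply: DK => //; have -> : k = a *: x - w by rewrite axE addrC addKr.
  apply: rpredD; first exact/mk_submodP.
  by apply/submodN/mk_submodP; exists n.
move: wW => /mk_submodP[u [uU wE]]; case: gax => + _; apply.
pose v i := if i == n then - (a *: x) else u i.
have vU i : v i \in U i by rewrite /v; case: eqP => [->|_] //; apply: submodN.
have := indep n.+1 v vU; rewrite big_ord_recr /= /v eqxx.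
rewrite (eq_bigr (fun i : 'I_n => u i)); last first.
  by move=> i _; rewrite (ltn_eqF (ltn_ord i)).
rewrite -wE axE k0 addr0 subrr => /(_ erefl n (ltnSn n)).
by rewrite eqxx => /eqP; rewrite oppr_eq0 => /eqP.
Qed.

End ModuleGenerality.

(** * The Jacobson radical *)

Section RightIdeals.
Variable R : pzRingType.
Implicit Types (I : submodClosed (right_reg R)) (x y r : R).

Lemma right_idealM I x r :
  (x : right_reg R) \in I -> ((x * r : R) : right_reg R) \in I.
Proof. exact: (@rpredZ _ _ I (r : conv_ring R) (x : right_reg R)). Qed.

Lemma right_ideal_axiom (P : R -> Prop) : P 0 ->
  (forall x y, P x -> P y -> P (x + y)) -> (forall x r, P x -> P (x * r)) ->
  submod_axiom (V := right_reg R) P.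
Proof. by move=> P0 PD PM; split=> // a x; apply: PM. Qed.

Lemma proper_in_maximal I : (1 : right_reg R) \notin I ->
  exists2 M : submodClosed (right_reg R), maximal_sub M & {subset I <= M}.
Proof.
apply: maximal_sub_above => y; exists (y : conv_ring R).
by rewrite -[LHS](mul1r (y : R)).
Qed.

Lemma maximal_proper M : @maximal_sub _ (right_reg R) M ->
  (1 : right_reg R) \notin M.
Proof.
move=> [[x xM] _]; apply: contra xM => M1.
by rewrite -[x](mul1r (x : R)); apply: right_idealM.
Qed.

Lemma maximal_comaximal M x : @maximal_sub _ (right_reg R) M ->
  (x : right_reg R) \notin M ->
  exists r (m : R), (m : right_reg R) \in M /\ 1 = m + x * r.
Proof.
move=> [_ maxM] xM.
have [|sM|all] := maxM (sum_sub M (cyclic_sub (x : right_reg R))).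
- exact: sum_subl.
- by case/negP: xM; rewrite -sM; apply/sum_subr/cyclic_sub_refl.
have /sum_subP[m [z [mM /cyclic_subP[r ->] E]]] := all (1 : R).
by exists r, m.
Qed.

Lemma jacobson_right_inv x : x \in @jacobson R -> exists y, (1 - x) * y = 1.
Proof.
move=> /asboolP xJ; apply: contrapT => ninv.
have [|M maxM sM] := @proper_in_maximal (cyclic_sub (1 - x : right_reg R)).
  by apply/negP => /eR_P[y E]; apply: ninv; exists y.
have /negP := maximal_proper maxM; apply.
rewrite -[X in X \in M](subrK x (1 : R)); apply: rpredD (xJ M maxM).
exact/sM/cyclic_sub_refl.
Qed.

Lemma jacobson_unit x : x \in @jacobson R ->
  exists y, (1 - x) * y = 1 /\ y * (1 - x) = 1.
Proof.
move=> xJ; have [y xy] := jacobson_right_inv xJ.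
have yE : y = 1 - - (x * y) by rewrite opprK -[X in X + _]xy mulrBl mul1r subrK.
have [|z] := @jacobson_right_inv (- (x * y)).
  by rewrite rpredN; apply: jacobsonMr.
rewrite -yE => yz; exists y; split=> //.
suff -> : 1 - x = z by [].
by rewrite -[LHS]mulr1 -[X in _ * X]yz mulrA xy mul1r.
Qed.

Lemma jacobson_of_right_inv x :
  (forall r, exists y, (1 - x * r) * y = 1) -> x \in @jacobson R.
Proof.
move=> inv; apply/asboolP => M maxM; apply/negPn/negP => xM.
have [r [m [mM E]]] := maximal_comaximal maxM xM.
have [y E'] := inv r; have /negP := maximal_proper maxM; apply.
by rewrite -[1 in X in X \in M]E'; apply: right_idealM; rewrite E addrK.
Qed.

(** Nakayama's lemma for cyclic modules, in terms of a generator. *)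
Lemma jacobson_fixr x j : j \in @jacobson R -> x = x * j -> x = 0.
Proof.
move=> /jacobson_unit[y [jy _]] xj.
by rewrite -[x]mulr1 -jy mulrA mulrBr mulr1 -xj subrr mul0r.
Qed.

Lemma jacobson_fixl x j : j \in @jacobson R -> x = j * x -> x = 0.
Proof.
move=> /jacobson_unit[y [_ yj]] jx.
by rewrite -[x]mul1r -yj -mulrA mulrBl mul1r -jx subrr mulr0.
Qed.

(** R/J(R) has no nonzero nilpotent right ideal: if (x r)^2 is in J then
    1 - (x r)^2 = (1 - x r)(1 + x r) is a unit. *)
Lemma jacobson_semiprime x :
  (forall r, x * r * x \in @jacobson R) -> x \in @jacobson R.
Proof.
move=> xJ; apply: jacobson_of_right_inv => r.
have [|y [E _]] := @jacobson_unit (x * r * (x * r)).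
  by rewrite mulrA; apply: jacobsonMr.
exists ((1 + x * r) * y); rewrite mulrA -[RHS]E; congr (_ * _).
by rewrite mulrDr mulr1 mulrBl mul1r addrA subrK.
Qed.

(** The only form in which semilocality is used. *)
Lemma semilocal_stable (f : nat -> R) : semilocal R ->
  (forall n, exists r, f n.+1 = f n * r) ->
  exists n r, f n - f n.+1 * r \in @jacobson R.
Proof.
move=> [_ artR] fP.
pose p (x : R) : right_reg (jacobson_quot_ring R) :=
  \pi_(jacobson_quot R)%qT x.
have pM x r : p (x * r) = (p r : conv_ring (jacobson_quot_ring R)) *: p x.
  by rewrite /p -jq_mulE.
have [|n nP] := artR (fun n => cyclic_sub (p (f n))).
  move=> n y /cyclic_subP[a ->]; have [r ->] := fP n.
  by apply/rpredZ/cyclic_subP; exists (p r).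
have /esym := nP n.+1 (leqnSn n) (p (f n)); rewrite cyclic_sub_refl.
move=> /esym/cyclic_subP[a E].
exists n, (repr (a : jacobson_quot R)); apply/jq_eqP.
by rewrite -[LHS]/(p (f n)) E -[RHS]/(p _) pM /p reprK.
Qed.

End RightIdeals.

(** * Cyclic injective hulls and self-injectivity *)

Section SelfInjective.
Variable R : pzRingType.

(** With s x = x t, the chain t^n R stabilises modulo J.  Applying powers of g
    to the resulting relation puts the generator y = x - s (g x) of ker g in
    y J, so y = 0 by Nakayama's argument. *)
Lemma cyclic_dedekind_finite (E : rmodType R) (g s : {linear E -> E}) :
  semilocal R -> cyclic_mod E -> cancel s g -> cancel g s.
Proof.
move=> semR [x gen] sK.
have [t sx] := gen (s x).
have sxn n : iter n s x = ((t : R) ^+ n : conv_ring R) *: x.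
  elim: n => [|n IH]; first by rewrite expr0 scale1r.
  by rewrite iterS IH linearZ /= sx scalerA exprS.
have gsn n z : iter n g (iter n s z) = z.
  by elim: n z => [|n IH] z //; rewrite iterSr /= sK IH.
have gZ n (r : conv_ring R) z : iter n g (r *: z) = r *: iter n g z.
  by elim: n => [|n IH] //=; rewrite IH linearZ.
have gD n z w : iter n g (z + w) = iter n g z + iter n g w.
  by elim: n => [|n IH] //=; rewrite IH linearD.
have [|n [r]] := @semilocal_stable R (fun n => (t : R) ^+ n) semR.
  by move=> n; exists t; rewrite exprSr.
set j := _ - _ => jJ.
have tn : (t : R) ^+ n = (t : R) ^+ n.+1 * r + j by rewrite /j addrC subrK.
have xE : x = (r : conv_ring R) *: s x + (j : conv_ring R) *: iter n g x.
  rewrite -[LHS](gsn n) sxn tn.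
  have -> : ((t : R) ^+ n.+1 * r + j : conv_ring R) *: x =
     (r : conv_ring R) *: iter n.+1 s x + (j : conv_ring R) *: x.
    by rewrite sxn scalerA -scalerDl.
  rewrite gD !gZ; congr (_ *: _ + _).
  by rewrite iterSr gsn.
have [w gx] := gen (iter n g x).
(* y generates the kernel of g, a direct summand of E; it lies in y J. *)
set y := x - s (g x).
have yE : y = ((w : R) * j : conv_ring R) *: y.
  have -> : ((w : R) * j : conv_ring R) *: y =
      (j : conv_ring R) *: ((w : conv_ring R) *: y) by rewrite scalerA.
  have sgx : s (g x) = (r : conv_ring R) *: s x +
      (j : conv_ring R) *: ((w : conv_ring R) *: s (g x)).
    by rewrite {1}xE gx 2!linearD 4!linearZ 2!linearZ /= sK.
  rewrite {1}/y sgx {1}xE gx opprD addrACA subrr add0r.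
  by rewrite -scalerBr -scalerBr.
have y0 : y = 0.
  have [v [vl vr]] := jacobson_unit (jacobsonMl (w : R) jJ).
  have : (1 - (w : R) * j : conv_ring R) *: y = 0.
    by rewrite scalerBl scale1r -yE subrr.
  move=> /(congr1 (fun z => (v : conv_ring R) *: z)).
  by rewrite scaler0 scalerA -[X in X *: y]/((1 - (w : R) * j) * v) vl scale1r.
move=> z; have [c ->] := gen z; rewrite !linearZ /=; congr (_ *: _).
by apply/eqP; rewrite eq_sym -subr_eq0; apply/eqP.
Qed.

Lemma retract_injective (A : pzRingType) (V E : lmodType A)
    (f : {linear V -> E}) (g : {linear E -> V}) :
  cancel f g -> injective_mod E -> injective_mod V.
Proof.
move=> fK injE M N i h injI; have [k kE] := injE M N i (f \o h) injI.
by exists (g \o k) => x /=; rewrite kE /= fK.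
Qed.

(** A cyclic injective hull of R over a semilocal ring is R itself. *)
Lemma self_injective_of_cyclic_hull :
  semilocal R -> cyclic_hull (right_reg R) -> injective_mod (right_reg R).
Proof.
move=> semR [E [[i [injI injE essI]] cycE]].
have [x gen] := cycE; have [a xa] := gen (i (1 : R)).
have iE (r : R) : i r = (r : conv_ring R) *: i (1 : R).
  by rewrite -linearZ /= -[X in i X = _](mul1r r).
have [g gE] : exists g : {linear E ->
  E}, forall r : R, g (i r) = (r : conv_ring R) *: x.
  have [|f fE] := @linear_of _ (right_reg R) E (fun r => (r : conv_ring R) *:
    x).
    by move=> c r r'; rewrite scalerDl scalerA.
  by have [g gE] := injE _ _ i f injI; exists g => r; rewrite gE fE.
have [h hE] : exists h : {linear E ->
  E}, forall r : R, h (i r) = i ((a : R) * r).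
  have [|f fE] := @linear_of _ (right_reg R) (right_reg R) (fun r => (a : R) *
    (r : R)).
    move=> c r r'; rewrite mulrDr; congr (_ + _).
    exact: (mulrA (a : R) (r : R) (c : R)).
  by have [h hE] := injE _ _ i (i \o f) injI; exists h => r; rewrite hE /= fE.
have ghE (r : R) : g (h (i r)) = i r.
  by rewrite hE gE [RHS]iE xa scalerA.
have [q qE] : exists q : {linear E -> E}, forall z, q (g (h z)) = z.
  apply: (injE E E (g \o h) idfun) => z w /= ghzw.
  have gh0 (v : E) : g (h v) = 0 -> v = 0.
    have kerP : submod_axiom (fun v => g (h v) = 0).
      split=> [|u u' gu gu'|c u gu]; first by rewrite !linear0.
        by rewrite !linearD gu gu' addr0.
      by rewrite !linearZ gu /= scaler0.
    move=> gv; apply: (essI (mk_submod kerP)); last exact/mk_submodP.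
    by move=> u /mk_submodP[r ->] /mk_submodP; rewrite ghE.
  by apply/eqP; rewrite -subr_eq0; apply/eqP/gh0;
    rewrite !linearB /= ghzw subrr.
have gK : cancel (q \o g) h := cyclic_dedekind_finite (g :=
  q \o g) semR cycE qE.
have ginj r : g (i r) = 0 -> r = 0.
  by move=> gr; apply: injI; rewrite -[LHS]gK /= gr !linear0.
have [|||k kE] := @linear_of_pairs _ E (right_reg R) (fun z r => z = g (i r)).
- split; first by rewrite !linear0.
    by move=> z r z' r' -> ->; rewrite !linearD.
  by move=> c z r ->; rewrite !linearZ.
- by move=> r /esym/ginj.
- by move=> z; have [r ->] := gen z; exists r; rewrite gE.
by apply: (@retract_injective _ _ _ (g \o i) k) injE => r; apply: kE.
Qed.

End SelfInjective.

(** * Local idempotents *)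

Section LocalIdempotents.
Variable R : pzRingType.
Implicit Types (e x y r : R).

(** The corner ring e R e is local with radical e J(R) e, said without forming
    the corner. *)
Definition local_elt e : Prop :=
  [/\ e * e = e, e <> 0
    & forall x, e * x * e \in @jacobson R \/
        exists y, (e * x * e) * (e * y * e) = e].

Definition uniform_elt e : Prop :=
  forall a b, e * a <> 0 -> e * b <> 0 ->
  exists r s, e * a * r = e * b * s /\ e * a * r <> 0.

Lemma idem_jacobson e : e * e = e -> e \in @jacobson R -> e = 0.
Proof. by move=> ee eJ; apply: (@jacobson_fixr R e e). Qed.

(** The top eR/eJ is simple: elements of eR outside J generate eR. *)
Lemma local_elt_right_inv e x : local_elt e ->
  e * x \notin @jacobson R -> exists r, e * x * r = e.
Proof.
move=> [ee e0 loc] exJ.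
have [r rJ] : exists r, (e * x * r * e) \notin @jacobson R.
  apply: contrapT => nr; case/negP: exJ; apply: jacobson_semiprime => r.
  apply: contrapT => /negP rJ; apply: nr; exists r.
  by apply: contra rJ => rJ; rewrite mulrA; apply: jacobsonMr.
case: (loc (x * r)) => [|[y yE]]; first by rewrite mulrA => /negPn; rewrite rJ.
by exists (r * e * (e * y * e)); rewrite -[RHS]yE !mulrA.
Qed.

Lemma local_elt_left_inv e x : local_elt e ->
  e * x * e \notin @jacobson R -> exists y, (e * y * e) * (e * x * e) = e.
Proof.
move=> [ee e0 loc] xJ; case: (loc x) => [/negPn|[y xy]]; first by rewrite xJ.
case: (loc y) => [yJ|[z yz]].
  case: e0; apply: idem_jacobson => //; rewrite -xy; exact: jacobsonMl.
exists y; set X := e * x * e; set Y := e * y * e; set Z := e * z * e.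
suff <- : Z = X by rewrite -[RHS]yz.
have -> : Z = e * Z by rewrite /Z !mulrA ee.
by rewrite -{1}xy -mulrA yz /X -mulrA ee.
Qed.

(** Indexing by an arbitrary finite type lets sums of families be indexed by
    the disjoint union. *)
Definition decomposes e : Prop := exists (T : finType) (f : T -> R),
  [/\ forall i, local_elt (f i), forall i j, i != j -> f i * f j = 0
    & \sum_i f i = e].

Lemma decomposes_add g h : g * h = 0 -> h * g = 0 ->
  decomposes g -> decomposes h -> decomposes (g + h).
Proof.
move=> gh hg [T [f [fl fo fs]]] [T' [f' [fl' fo' fs']]].
have fg i : f i * g = f i.
  rewrite -fs mulr_sumr (bigD1 i) //= big1 => [|j /negbTE ji].
    by rewrite addr0; case: (fl i).
  by rewrite fo // eq_sym ji.
have gf i : g * f i = f i.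
  rewrite -fs mulr_suml (bigD1 i) //= big1 => [|j ji]; last exact: fo.
  by rewrite addr0; case: (fl i).
have fh i : f' i * h = f' i.
  rewrite -fs' mulr_sumr (bigD1 i) //= big1 => [|j /negbTE ji].
    by rewrite addr0; case: (fl' i).
  by rewrite fo' // eq_sym ji.
have hf i : h * f' i = f' i.
  rewrite -fs' mulr_suml (bigD1 i) //= big1 => [|j ji]; last exact: fo'.
  by rewrite addr0; case: (fl' i).
exists (T + T')%type, (fun t => match t with inl i => f i | inr j => f' j end).
split; last by rewrite big_sumType /= fs fs'.
  by case.
move=> [i|i] [j|j] ij; first exact: fo.
- by rewrite -fg -hf -mulrA (mulrA g) gh mul0r mulr0.
- by rewrite -fh -gf -mulrA (mulrA h) hg mul0r mulr0.
- exact: fo'.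
Qed.

End LocalIdempotents.

(** * Element calculus in a right self-injective ring *)

Section InjectiveElements.
Variable R : pzRingType.
Hypothesis injR : injective_mod (right_reg R).
Implicit Types (e x y r : R).

(** Partial endomorphisms of R as a right module are given by left
    multiplications. *)
Lemma left_mult_extend (G : R -> R -> Prop) : G 0 0 ->
  (forall x y x' y', G x y -> G x' y' -> G (x + x') (y + y')) ->
  (forall x y r, G x y -> G (x * r) (y * r)) ->
  (forall y, G 0 y -> y = 0) ->
  exists c, forall x y, G x y -> c * x = y.
Proof.
move=> G0 GD GM G1.
have [|f fG] := @injective_extend _ (right_reg R) (right_reg R) G injR _ G1.
  by split=> // a x y; apply: GM.
exists (f (1 : R)) => x y /fG <-.
have E : f ((x : conv_ring R) *: (1 : right_reg R)) = (x : conv_ring R) *: f (1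
  : R).
  by rewrite linearZ.
by rewrite -[LHS]E; apply: (congr1 f); apply: (mul1r (x : R)).
Qed.

Lemma baer_ann a b : (forall r, a * r = 0 -> b * r = 0) -> exists c, c * a = b.
Proof.
move=> ab.
have [|x y x' y' [r [-> ->]] [r' [-> ->]]|x y s [r [-> ->]]|y [r [/esym/ab ar
  ->]]|c cP] //
   := @left_mult_extend (fun x y => exists r, x = a * r /\ y = b * r).
- by exists 0; rewrite !mulr0.
- by exists (r + r'); rewrite !mulrDr.
- by exists (r * s); rewrite !mulrA.
by exists c; apply: cP; exists 1; rewrite !mulr1.
Qed.

(** If r(z) is essential then every 1 - b z r is left regular, hence left
    invertible by self-injectivity.  Conversely, for z in J, left
    multiplication by z on a right ideal that meets r(z) trivially has a left
    inverse c, and then 1 - c z is a unit killing that ideal. *)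
Lemma right_singular_jacobson (z : R) :
  singular_mem (z : right_reg R) <-> z \in @jacobson R.
Proof.
have annE x r : ((r : left_reg (conv_ring R)) \in ann (x : right_reg R)) <-> x
  * r = 0.
  exact: ann_rightP.
split=> [sz|zJ].
  (* If s = b z r s with s nonzero, the essential right ideal r(z) contains
     some nonzero r s t, and then s t = b z r s t = 0. *)
  have linv (b r : R) : exists d, d * (1 - b * z * r) = 1.
    have [s|d dE] := @baer_ann (1 - b * z * r) 1; last by exists d.
    rewrite mulrBl !mul1r => /eqP; rewrite subr_eq0 => /eqP sE.
    apply: contrapT => s0.
    have rs0 : r * s <> 0 by move=> rs; apply: s0;
      rewrite sE -(mulrA _ r s) rs mulr0.
    have [t [rst0 /annE zt]] := essentialE sz rs0.
    apply: rst0; rewrite -[LHS]/(r * s * (t : R)) -mulrA.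
    have -> : s * (t : R) = 0 by rewrite sE -(mulrA _ r s) -!mulrA [X in z *
      X]mulrA zt mulr0.
    exact: (@mulr0 R r).
  apply: jacobson_of_right_inv => r; have [b bE] := linv 1 r.
  rewrite mul1r in bE; have [d dE] := linv b (- r).
  have bE' : 1 - b * z * - r = b.
    by rewrite mulrN opprK -mulrA -{1}bE mulrBr mulr1 subrK.
  rewrite bE' in dE; exists b; suff <- : d = 1 - z * r by [].
  by rewrite -[LHS]mulr1 -[X in d * X]bE mulrA dE mul1r.
apply: essential_of => x x0.
case: (pselect (exists a : conv_ring R, a *: x <> 0 /\
  a *: x \in ann (z : right_reg R))) => // nex.
have [r zr|c cE] := @baer_ann (z * (x : R)) (x : R).
  apply: contrapT => xr0; apply: nex; exists r; split=> //.
  by apply/annE; rewrite mulrA.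
case: x0; apply: (@jacobson_fixl R _ (c * z)); first exact: jacobsonMl.
by rewrite -mulrA cE.
Qed.

End InjectiveElements.

(** * Decomposition into local idempotents *)

Section Decomposition.
Variable R : pzRingType.
Hypothesis injR : injective_mod (right_reg R).
Implicit Types (e f g x y r : R) (I : submodClosed (right_reg R)).

(** Enlarge I2 to a right ideal C maximal with zero intersection with I1, and
    then I1 to K maximal with zero intersection with C.  The projection of
    K + C to K extends to left multiplication by some c; maximality of C and K
    forces cR = K, so c is idempotent. *)
Lemma separating_idempotent I1 I2 : (forall x, x \in I1 -> x \in I2 -> x = 0) ->
  exists c : R, [/\ c * c = c, forall a : R, (a : right_reg R) \in I1 ->
    c * a = a
    & forall b : R, (b : right_reg R) \in I2 -> c * b = 0].
Proof.
move=> I12.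
have [|C [I2C C1 maxC]] := @maximal_avoiding _ (right_reg R) I2
  (fun x => x \in I1 /\ x <> 0).
  by move=> x xI2 [xI1]; apply; apply: I12.
have [|K [I1K KC maxK]] := @maximal_avoiding _ (right_reg R) I1
  (fun x => x \in C /\ x <> 0).
  by move=> x xI1 [xC x0]; apply: C1 xC _.
have CK x : x \in C -> x \in K -> x = 0.
  by move=> xC xK; apply: contrapT => x0; apply: (KC x xK).
have [|x y x' y' [k [d [kK dC -> ->]]] [k' [d' [k'K d'C -> ->]]]
      |x y r [k [d [kK dC -> ->]]]|y [k [d [kK dC kd ->]]]|c cP] :=
  @left_mult_extend R injR (fun x y => exists k d : R,
    [/\ (k : right_reg R) \in K, (d : right_reg R) \in C, x = k + d & y = k]).
- by exists 0, 0; rewrite !rpred0 addr0.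
- by exists (k + k'), (d + d'); rewrite !rpredD // addrACA.
- exists (k * r), (d * r); split; rewrite ?mulrDl //; exact: right_idealM.
- apply: CK => //; have -> : k = - d by apply/eqP; rewrite -addr_eq0 -kd.
  exact: submodN.
have cK (k : R) : (k : right_reg R) \in K -> c * k = k.
  by move=> kK; apply: cP; exists k, 0; rewrite rpred0 addr0.
have cC (d : R) : (d : right_reg R) \in C -> c * d = 0.
  by move=> dC; apply: cP; exists 0, d; rewrite rpred0 add0r.
(* If cx is in C but x is not, then C + xR contains a nonzero k = d + xr of I1,
   and k = ck = cxr lies both in K and in C. *)
have cRC (x : R) : (c * x : right_reg R) \in C -> c * x = 0.
  move=> cxC; apply: contrapT => cx0.
  have [xC|xC] := boolP ((x : right_reg R) \in C); first by apply/cx0/cC.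
  case: (pselect (forall z, z \in sum_sub C (cyclic_sub (x : right_reg R)) ->
            ~ (z \in I1 /\ z <> 0))) => [av|nav].
    case/negP: xC; apply: (maxC _ _ av); first exact: sum_subl.
    exact/sum_subr/cyclic_sub_refl.
  move/existsNP: nav => [k /not_implyP[/sum_subP[d [w [dC /cyclic_subP[r ->]
    kE]]]]].
  move=> /contrapT[kI1]; apply.
  have kK := I1K _ kI1; apply: CK => //.
  have -> : k = (c * x : R) * (r : R).
    rewrite -(cK _ kK) kE mulrDr cC // add0r; exact: (mulrA c (x : R) (r : R)).
  exact: right_idealM.
have cRK (x : R) : (c * x : right_reg R) \in K.
  apply: (maxK (cyclic_sub (c : right_reg R))) => [k kK|z /cyclic_subP[r ->]
    [zC]|].
  - by apply/cyclic_subP; exists k; rewrite -[LHS](cK _ kK).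
  - by apply; apply: cRC.
  - by apply/eR_P; exists x.
exists c; split=> [|a aI|b bI].
- by have := cRK 1; rewrite mulr1 => /cK.
- exact/cK/I1K.
- exact/cC/I2C.
Qed.

Lemma split_not_uniform f : f * f = f -> ~ uniform_elt f ->
  exists g, [/\ g * g = g, f * g = g, g * f = g, g <> 0 & g <> f].
Proof.
move=> ff; move/existsNP=> [a /existsNP[b /not_implyP[a0 /not_implyP[b0 ab]]]].
have [|c [cc ca cb]] :=
  @separating_idempotent (cyclic_sub (f * a : right_reg R))
  (sum_sub (cyclic_sub (f * b : right_reg R)) (cyclic_sub (1 - f : right_reg
    R))).
  move=> x /cyclic_subP[r xE] /sum_subP[y [z [/cyclic_subP[s yE] /cyclic_subP[t
    zE] xE']]].
  apply: contrapT => x0; apply: ab; exists r, s; split.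
    have E : f * a * (r : R) = f * b * (s : R) + (1 - f) * (t : R).
      by move: xE'; rewrite xE yE zE.
    move/(congr1 (fun z => f * z)): E.
    by rewrite mulrDr !mulrA ff mulrBr mulr1 ff subrr mul0r addr0.
  by move=> far; apply: x0; rewrite xE.
have cf : c * f = c.
  apply/eqP; rewrite eq_sym -subr_eq0 -{1}[c]mulr1 -mulrBr; apply/eqP/cb.
  exact/sum_subr/cyclic_sub_refl.
exists (f * c); split.
- by rewrite !mulrA -(mulrA f c f) cf -mulrA cc.
- by rewrite mulrA ff.
- by rewrite -mulrA cf.
- move=> fc; apply: a0; have <- : f * c * (f * a) = f * a.
    by rewrite -mulrA ca ?cyclic_sub_refl // mulrA ff.
  by rewrite fc mul0r.
- move=> fc; apply: b0;
  have <- : f * c * (f * b) = f * b by rewrite fc mulrA ff.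
  by rewrite -mulrA cb ?mulr0 //; apply/sum_subl/cyclic_sub_refl.
Qed.

(** An endomorphism of the uniform injective module fR is either injective,
    hence split, hence invertible, or it has essential kernel, hence lies in
    the singular ideal J. *)
Lemma local_of_uniform f : f * f = f -> f <> 0 -> uniform_elt f -> local_elt f.
Proof.
move=> ff f0 unif.
have inv x : f * x * f \notin @jacobson R ->
    exists y, (f * y * f) * (f * x * f) = f.
  move=> xJ; have [r|c cE] := @baer_ann R injR (f * x * f) f.
    move=> xr; apply: contrapT => fr; case/negP: xJ.
    apply/(right_singular_jacobson injR)/essential_of => z z0.
    case: (pselect (f * (z : R) = 0)) => [fz|fz].
      exists (1 : R); rewrite scale1r; split=> //; apply/ann_rightP.
      by rewrite -mulrA fz mulr0.
    have [s [t [E fzs]]] := unif _ _ fz fr.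
    exists s; split=> [zs|].
      by apply: fzs; rewrite -mulrA [X in f * X]zs mulr0.
    apply/ann_rightP; rewrite -[LHS]/(f * x * f * ((z : R) * s)) -mulrA (mulrA
      f z) E.
    by rewrite !mulrA xr mul0r.
  by exists c; rewrite -[RHS]ff -{6}cE !mulrA -(mulrA (f * c)) ff.
split=> // x; have [|xJ] := boolP (f * x * f \in @jacobson R); first by left.
right; have [y yx] := inv x xJ.
have [|z zy] := inv y.
  by apply/negP => yJ; apply/f0/idem_jacobson => //; rewrite -yx;
    apply: jacobsonMr.
exists y; set X := f * x * f; set Y := f * y * f; set Z := f * z * f.
suff <- : Z = X by rewrite -[RHS]zy.
have -> : Z = Z * f by rewrite /Z -(mulrA _ f f) ff.
by rewrite -[in LHS]yx mulrA zy /X !mulrA ff.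
Qed.

Lemma uniform_of_local f : local_elt f -> uniform_elt f.
Proof.
move=> locf; have [ff f0 _] := locf.
apply: contrapT => /(split_not_uniform ff)[g [gg fg gf g0 gf']].
have gE : f * g * f = g by rewrite fg gf.
have gJ : f * g * f \notin @jacobson R.
  by rewrite gE; apply/negP => /(idem_jacobson gg).
have [y yg] := local_elt_left_inv locf gJ; rewrite gE in yg.
by apply: gf'; rewrite -fg -yg -mulrA gg yg.
Qed.

(** Otherwise 1 would start an infinite chain of idempotents, each a proper
    direct summand of its predecessor; such a chain does not stabilise modulo
    J, since J contains no nonzero idempotent. *)
Lemma decomposition : semilocal R -> decomposes (1 : R).
Proof.
move=> semR; apply: contrapT => bad1.
pose bad (f : R) := f * f = f /\ ~ decomposes f.
have step (f : {f | bad f}) : exists g : {g | bad g},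
    [/\ sval f * sval g = sval g, sval g * sval f = sval g & sval g <> sval f].
  case: f => f [ff badf] /=.
  have f0 : f <> 0.
    move=> f0; apply: badf; exists void, (fun=> 0); split; try by case.
    by rewrite f0 big1 //; case.
  case: (pselect (uniform_elt f)) => [uf|/(split_not_uniform ff)[g [gg fg gf g0
    gf']]].
    case: badf; exists unit, (fun=> f); split.
    - by move=> _; apply: local_of_uniform.
    - by move=> [] [].
    - by rewrite (bigD1 tt) //= big1 ?addr0 //; case.
  case: (pselect (decomposes g)) => dg; last first.
    by exists (exist _ g (conj gg dg)).
  have hh : (f - g) * (f - g) = f - g.
    by rewrite mulrBl !mulrBr ff fg gf gg subrr subr0.
  have dh : ~ decomposes (f - g).
    move=> dh; apply: badf; rewrite -(subrK g f); apply: decomposes_add => //.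
      by rewrite mulrBl fg gg subrr.
    by rewrite mulrBr gf gg subrr.
  exists (exist _ (f - g) (conj hh dh)); split=> /=.
  - by rewrite mulrBr ff fg.
  - by rewrite mulrBl ff gf.
  - by move/eqP; rewrite -subr_eq0 addrC addKr oppr_eq0 => /eqP.
pose next (f : {f | bad f}) := projT1 (cid (step f)).
have nextP (f : {f | bad f}) : [/\ sval f * sval (next f) = sval (next f),
    sval (next f) * sval f = sval (next f) & sval (next f) <> sval f].
  by rewrite /next; case: cid.
have one_bad : bad 1 by split=> //; rewrite mulr1.
pose f n : R := sval (iter n next (exist _ 1 one_bad)).
have [|n [r]] := @semilocal_stable R f semR.
  by move=> n; exists (f n.+1); have [] :=
    nextP (iter n next (exist _ 1 one_bad)).
rewrite /f iterS; move: (iter n next _) => F; have [fg gf gf'] := nextP F.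
have [ff _] := svalP F; have [gg _] := svalP (next F).
move=> /(@jacobsonMl _ _ (sval F - sval (next F))).
rewrite mulrBl !mulrBr ff gf mulrA fg mulrA gg opprB addrA subrK => hJ.
apply: gf'; apply/eqP; rewrite eq_sym -subr_eq0; apply/eqP/idem_jacobson => //.
by rewrite mulrBl !mulrBr ff fg gf gg subrr subr0.
Qed.

End Decomposition.

(** * The duo condition and tops of local idempotents *)

Section Tops.
Variable R : pzRingType.
Hypothesis injR : injective_mod (right_reg R).
Implicit Types (e f g x y r : R) (I : submodClosed (right_reg R)).

Definition kills_jacobson x : Prop := forall j, j \in @jacobson R -> x * j = 0.

Lemma top_right_inv e a x : local_elt e -> a * e = a -> kills_jacobson a ->
  a * x <> 0 -> exists r, e * x * r = e.
Proof.
move=> loce ae aJ ax0; apply: local_elt_right_inv => //.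
by apply/negP => exJ; apply: ax0; rewrite -ae -mulrA aJ.
Qed.

(** If a e = a and aJ = 0 with a nonzero, then r(a) = (1 - e)R + eJ; so two
    such elements are left multiples of each other. *)
Lemma top_left_mult e a b : local_elt e -> a <> 0 -> a * e = a ->
  b * e = b -> kills_jacobson b -> exists c, c * a = b.
Proof.
move=> loce a0 ae be bJ; apply: baer_ann => // x ax; apply: contrapT => bx0.
have [r exr] := top_right_inv loce be bJ bx0.
by apply: a0; rewrite -ae -exr !mulrA ae ax mul0r.
Qed.

Lemma kills_jacobsonMl a x : kills_jacobson a -> kills_jacobson (x * a).
Proof. by move=> aJ j jJ; rewrite -mulrA aJ // mulr0. Qed.

Lemma kills_jacobsonMr a x : kills_jacobson a -> kills_jacobson (a * x).
Proof. by move=> aJ j jJ; rewrite -mulrA aJ //; apply: jacobsonMl. Qed.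

Hypothesis duoR : essentially_right_duo R.

(** The right ideal aR + (1 - e)R, for nonzero a in eR, is essential because eR
    is uniform; hence it contains r (1 - e), and one multiplies by e. *)
Lemma duo_minimal e a r : local_elt e -> e * a <> 0 ->
  exists s, e * r * (1 - e) = e * a * s.
Proof.
move=> loce ea0; have [ee e0 _] := loce.
pose I := sum_sub (cyclic_sub (e * a : right_reg R))
                  (cyclic_sub (1 - e : right_reg R)).
have essI : essential I.
  apply: essential_of => x x0.
  have xE (y : R) : y = e * y + (1 - e) * y by rewrite -mulrDl addrC subrK
    mul1r.
  case: (pselect (e * (x : R) = 0)) => [ex|ex].
    exists (1 : R); rewrite scale1r; split=> //.
    by rewrite (xE x) ex add0r; apply/sum_subr/eR_P; exists x.
  have [s [t [E exs]]] := uniform_of_local injR loce ex ea0.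
  exists s; split=> [xs|]; first by apply: exs;
    rewrite -mulrA [X in e * X]xs mulr0.
  apply/sum_subP; exists (e * a * t), ((1 - e) * ((x : R) * s)); split.
  - by apply/eR_P; exists t.
  - by apply/eR_P; exists ((x : R) * s).
  - by rewrite -E -(mulrA e); apply: xE.
have : (r * (1 - e) : right_reg R) \in I.
  by apply: duoR => //; apply/sum_subr/cyclic_sub_refl.
move=> /sum_subP[y [z [/eR_P[s ->] /eR_P[t ->] E]]]; exists s.
have {}E : r * (1 - e) = e * a * s + (1 - e) * t := E.
by rewrite -mulrA E mulrDr !mulrA ee mulrBr mulr1 ee subrr mul0r addr0.
Qed.

Definition mixed e : Prop := exists r, e * r * (1 - e) <> 0.

Lemma mixed_kills e r : local_elt e -> kills_jacobson (e * r * (1 - e)).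
Proof.
move=> loce j jJ; apply: contrapT => uj0; set u := e * r * (1 - e) in uj0.
have [|s uE] := @duo_minimal e (r * (1 - e) * j) r loce.
  by rewrite !mulrA.
apply: uj0; suff -> : u = 0 by rewrite mul0r.
apply: (@jacobson_fixr R u (j * s)); first exact: jacobsonMr.
by rewrite {1}/u uE !mulrA.
Qed.

Variables (T : finType) (e : T -> R).
Hypothesis e_local : forall i, local_elt (e i).
Hypothesis e_orth : forall i j, i != j -> e i * e j = 0.
Hypothesis e_sum : \sum_i e i = 1.

Let ee i : e i * e i = e i. Proof. by case: (e_local i). Qed.
Let e0 i : e i <> 0. Proof. by case: (e_local i). Qed.

Lemma nonzero_comp_r x : x <> 0 -> exists i, x * e i <> 0.
Proof.
move=> x0; apply: contrapT => ne; apply: x0.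
rewrite -[x]mulr1 -e_sum mulr_sumr big1 // => i _.
by apply: contrapT => xi; apply: ne; exists i.
Qed.

Lemma nonzero_comp_l x : x <> 0 -> exists i, e i * x <> 0.
Proof.
move=> x0; apply: contrapT => ne; apply: x0.
rewrite -[x]mul1r -e_sum mulr_suml big1 // => i _.
by apply: contrapT => xi; apply: ne; exists i.
Qed.

(** The top of e_k R occurs as a simple submodule of e_i R. *)
Definition top_in i k : Prop :=
  exists u, [/\ u <> 0, e i * u = u, u * e k = u & kills_jacobson u].

(** e_i R and e_j R are isomorphic: an element of e_i R e_j outside J induces an
    isomorphism between their tops. *)
Definition top_iso i j : Prop := exists c, e i * c * e j \notin @jacobson R.

Lemma mixed_top_in i : mixed (e i) -> exists k, top_in i k.
Proof.
move=> [r u0]; have [k uk0] := nonzero_comp_r u0; exists k.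
exists (e i * r * (1 - e i) * e k); split=> //.
- by rewrite !mulrA ee.
- by rewrite -mulrA ee.
- exact/kills_jacobsonMr/mixed_kills.
Qed.

(** Let u generate a copy of the top of e_k R in e_i R, with k <> i.  If z is a
    nonzero element of e_k J e_k, then zR maps onto uR by left multiplication
    with some c in e_i R e_k; this c lies in e_i R (1 - e_i), hence kills J, so
    that u = c z = 0.  Thus e_k J e_k = 0.  If e_k were not mixed, e_k R would
    be simple and isomorphic to uR, and the inverse isomorphism would extend to
    left multiplication by an element of e_k R e_i = 0. *)
Lemma top_in_mixed i k : mixed (e i) -> top_in i k -> mixed (e k).
Proof.
move=> mi [u [u0 eu ue uJ]].
have [<- //|ik] := eqVneq i k.
have eki : e k * e i = 0 by apply: e_orth; rewrite eq_sym.
have eik : e i * e k = 0 by apply: e_orth.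
apply: contrapT => nk.
have nkE x : e k * x = e k * x * e k.
  apply/eqP; rewrite -subr_eq0 -{1}[e k * x]mulr1 -mulrBr; apply/eqP.
  by apply: contrapT => x0; apply: nk; exists x.
have red z : e k * z \in @jacobson R -> e k * z = 0.
  move=> zJ; apply: contrapT => z0; apply: u0.
  have [c cz] : exists c, c * (e k * z) = u.
    by apply: (top_left_mult (e_local k)) => //; rewrite -nkE.
  have uE : e i * (c * e k) * (1 - e i) * (e k * z) = u.
    rewrite mulrBr mulr1 -(mulrA (e i) _ (e i)) -(mulrA c) eki mulr0 mulr0
      subr0.
    by rewrite -mulrA -(mulrA c) (mulrA (e k)) ee cz.
  by rewrite -uE; apply: mixed_kills.
have [c cu] : exists c, c * u = e k.
  apply: baer_ann => // x ux; apply: contrapT => kx0.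
  have [r kxr] : exists r, e k * x * r = e k.
    by apply: local_elt_right_inv => //; apply/negP => /red.
  by apply: u0; rewrite -ue -kxr !mulrA ue ux mul0r.
have kci : e k * (c * e i) = 0 by rewrite nkE -!mulrA eik !mulr0.
apply: (e0 (i := k)); rewrite -(ee k) -[X in _ * X]cu -eu.
by rewrite (mulrA c) mulrA kci mul0r.
Qed.

Lemma top_iso_refl i : top_iso i i.
Proof.
by exists (e i); rewrite !ee; apply/negP => /(idem_jacobson (ee i))/e0.
Qed.

Lemma top_iso_sym i j : top_iso i j -> top_iso j i.
Proof.
move=> [c cJ]; have [|r cr] :=
  @local_elt_right_inv R (e i) (c * e j) (e_local i).
  by rewrite mulrA.
exists r; apply/negP => rJ; apply: (e0 (i := i)); apply: (idem_jacobson (ee i)).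
rewrite -(ee i) -{1}cr -(ee j) !mulrA -(mulrA _ (e j) r) -mulrA.
exact: jacobsonMl.
Qed.

Lemma top_in_iso h i j : top_in h i -> top_iso i j -> top_in h j.
Proof.
move=> [u [u0 eu ue uJ]] [c cJ]; exists (u * (c * e j)); split.
- have [|r cr] := @local_elt_right_inv R (e i) (c * e j) (e_local i).
    by rewrite mulrA.
  move=> ucj; apply: u0; rewrite -ue -cr !mulrA ue.
  by rewrite -(mulrA u c) ucj mul0r.
- by rewrite mulrA eu.
- by rewrite -!mulrA ee.
- exact: kills_jacobsonMr.
Qed.

(** Both e_i R and e_j R are injective hulls of the top of e_k R. *)
Lemma top_in_inj i j k : top_in i k -> top_in j k -> top_iso i j.
Proof.
move=> [u [u0 eu ue uJ]] [v [v0 ev ve vJ]].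
have [c cv] := top_left_mult (e_local k) v0 ve ue uJ.
have [d du] := top_left_mult (e_local k) u0 ue ve vJ.
exists c; apply/negP => cJ; apply: u0;
  apply: (@jacobson_fixl R _ (e i * c * e j * d)).
  exact: jacobsonMr.
by rewrite -!mulrA du ev cv eu.
Qed.

(** The top of fR embeds in R, through f + fJ |-> a. *)
Definition top_embeds f : Prop :=
  exists a, [/\ a <> 0, a * f = a & kills_jacobson a].

(** Follow i = f 0, f 1, f 2, ... where the top of f (n+1) is the socle of f n.
    Some top is repeated, and by injectivity the repetition can be moved back
    to the start; so the top of f 0 is the socle of some f p. *)
Lemma mixed_top_embeds i : mixed (e i) -> top_embeds (e i).
Proof.
move=> mi.
have step (k : {k | mixed (e k)}) : exists l : {k | mixed (e k)}, top_in (sval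
  k) (sval l).
  case: k => k mk; have [l kl] := mixed_top_in mk.
  by exists (exist _ l (top_in_mixed mk kl)).
pose next (k : {k | mixed (e k)}) := projT1 (cid (step k)).
pose f n := sval (iter n next (exist _ i mi)).
have fS n : top_in (f n) (f n.+1) by rewrite /f iterS /next; case: cid.
have back p m : top_iso (f m) (f (m + p)%N) -> top_iso (f 0%N) (f p).
  elim: m => [//|m IH] mp; apply: IH; apply: top_in_inj (fS m) _.
  by apply: top_in_iso (fS _) _; apply: top_iso_sym; rewrite -addSn.
have [m [p fmp]] : exists m p, f m = f (m + p.+1)%N.
  have /injectivePn[a [b ab fab]] : ~~ injectiveb (fun k : 'I_#|T|.+1 => f k).
    apply/injectiveP => /leq_card; rewrite card_ord.
    by rewrite ltnn.
  wlog : a b ab fab / (a < b)%N.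
    move=> W; have := ab; rewrite neq_ltn => /orP[|ba]; first exact: W.
    by apply: (W b a) => //; rewrite eq_sym.
  by move=> lab; exists a, (b - a).-1;
    rewrite prednK ?subn_gt0 // subnKC // ltnW.
have := back p.+1 m; rewrite -fmp => /(_ (top_iso_refl _)) i_p.
have [u [u0 _ ue uJ]] : top_in (f p) (f 0%N).
  by apply: top_in_iso (fS p) _; apply: top_iso_sym.
by exists u.
Qed.

End Tops.

(** * Embedding the tops of unmixed local idempotents *)

(** The simple module eR/eJ, to which the hypothesis on injective hulls is
    applied, is realised as the submodule generated by the class of e in R/J,
    viewed as a right R-module. *)
Section JacobsonQuotientModule.
Variable R : pzRingType.
Local Open Scope quotient_scope.

Definition jacobson_quot_right : Type := jacobson_quot_ring R.

HB.instance Definition _ := GRing.Zmodule.on jacobson_quot_right.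

Definition jqr_scale (r : conv_ring R) (x : jacobson_quot_right) :
  jacobson_quot_right := (x : jacobson_quot_ring R) * \pi_(jacobson_quot R) (r
    : R).

Fact jqr_scaleA a b v : jqr_scale a (jqr_scale b v) = jqr_scale (a * b) v.
Proof. by rewrite /jqr_scale -mulrA; congr (_ * _); apply: jq_mulE. Qed.

Fact jqr_scale1 : left_id 1 jqr_scale.
Proof. by move=> v; apply: mulr1. Qed.

Fact jqr_scaleDr : right_distributive jqr_scale +%R.
Proof. by move=> a u v; apply: mulrDl. Qed.

Fact jqr_scaleDl v : {morph jqr_scale^~ v : a b / a + b}.
Proof.
by move=> a b; rewrite /jqr_scale -mulrDr jq_addE.
Qed.

HB.instance Definition _ := GRing.Zmodule_isLmodule.Build (conv_ring R)
  jacobson_quot_right jqr_scaleA jqr_scale1 jqr_scaleDr jqr_scaleDl.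

Definition jacobson_quot_mod : rmodType R :=
  GRing.Lmodule.clone (conv_ring R) jacobson_quot_right _.

Definition jqr_pi (x : R) : jacobson_quot_mod := \pi_(jacobson_quot R) x.

Lemma jqr_piM (x r : R) : (r : conv_ring R) *: jqr_pi x = jqr_pi (x * r).
Proof. exact: jq_mulE. Qed.

Lemma jqr_pi_eq0 (x : R) : jqr_pi x = 0 <-> x \in @jacobson R.
Proof.
have -> : (0 : jacobson_quot_mod) = jqr_pi 0.
  apply: (addrI (jqr_pi 0)); rewrite addr0.
  by apply: esym; rewrite -[in RHS](addr0 (0 : R)); apply: jq_addE.
by rewrite -[X in X \in _]subr0; split=> [/jq_eqP|xJ]; last exact/jq_eqP.
Qed.

Lemma jqr_pi_simple (e : R) : local_elt e -> simple_elt (jqr_pi e).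
Proof.
move=> loce; have [ee e0 _] := loce; split.
  by move/jqr_pi_eq0/(idem_jacobson ee).
move=> x; rewrite jqr_piM => ex.
have [|r exr] := @local_elt_right_inv R e (x : R) loce.
  by apply/negP => /jqr_pi_eq0.
by exists r; rewrite jqr_piM exr.
Qed.

End JacobsonQuotientModule.

Section UnmixedTops.
Variable R : pzRingType.
Hypothesis injR : injective_mod (right_reg R).
Hypothesis duoR : essentially_right_duo R.
Hypothesis hypR : right_hypersimple R.

Lemma unmixed_top_embeds (e : R) : local_elt e -> ~ mixed e -> top_embeds e.
Proof.
move=> loce unmix; have [ee e0 _] := loce.
have eRe x : e * x = e * x * e.
  apply/eqP; rewrite -subr_eq0 -{1}[e * x]mulr1 -mulrBr; apply/eqP.
  by apply: contrapT => x0; apply: unmix; exists x.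
have gs := jqr_pi_simple loce; set s := jqr_pi e in gs.
have [E [[i [injI injE essI]] [x gen]]] := hypR (simple_elt_cyclic_sub gs).
pose w := i (Sub s (cyclic_sub_refl s)).
have w0 : w <> 0.
  move=> w0; have [s0 _] := gs; apply: s0.
  by apply: (congr1 val (injI (Sub s (cyclic_sub_refl s)) 0 _));
    rewrite linear0.
have wr (r : R) : e * r \in @jacobson R -> (r : conv_ring R) *: w = 0.
  move=> erJ; rewrite /w -linearZ -[RHS](linear0 i); congr (i _).
  by apply: val_inj; rewrite linearZ /= jqr_piM; apply/jqr_pi_eq0.
have scaleM (a b : R) v : (a * b : conv_ring R) *: v = (b : conv_ring R) *: ((a
  : conv_ring R) *: v) :> E.
  by rewrite scalerA.
have [wx wxE] := gen w.
pose I := ann x.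
case: (pselect (essential I)) => [essA|nessA].
  have Ie (t : R) : (t : right_reg R) \in I -> t * e = 0.
    move=> tI; apply: contrapT => te0.
    pose G (y : right_reg R) (z : E) :=
      exists r : R, y = t * e * r /\ z = (r : conv_ring R) *: w.
    have GP : pairs_submod G.
      split; first by exists 0; rewrite mulr0 scale0r.
        move=> y z y' z' [r [-> ->]] [r' [-> ->]]; exists (r + r').
        by rewrite mulrDr scalerDl.
      by move=> a y z [r [-> ->]]; exists (r * (a : R)); rewrite mulrA scaleM.
    have [z [r [/esym ter ->]]|f fP] := injective_extend injE GP.
      apply: wr; apply: contrapT => /negP erJ; apply: te0.
      have [r' err] := local_elt_right_inv loce erJ.
      by rewrite -err !mulrA ter mul0r.
    (* f (t e) = x b (t e) for f 1 = x b, and b t lies in the ideal I. *)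
    have [b bE] := gen (f (1 : R)).
    have fte : f (t * e : R) = w by apply: fP; exists 1; rewrite mulr1 scale1r.
    apply: w0; rewrite -fte.
    have -> : f (t * e : R) = ((b : R) * (t * e) : conv_ring R) *: x.
      rewrite scaleM -bE -linearZ; apply: (congr1 f).
      by apply: esym (mul1r (t * e)).
    have : ((b : R) * (t * e) : right_reg R) \in I.
      by apply: duoR => //; apply: right_idealM.
    by move=> /mk_submodP.
  have [a [ea0 eaI]] := essentialE essA (e0 : (e : right_reg R) <> 0).
  case: ea0; have eaI' : (e * (a : R) : right_reg R) \in I := eaI.
  by rewrite -[LHS]/(e * (a : R)) eRe Ie.
have [q [q0 qI]] : exists q : R, q <> 0 /\
  forall r : R, (q * r : right_reg R) \in I -> q * r = 0.
  apply: contrapT => nq; apply: nessA; apply: essential_of => q q0.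
  apply: contrapT => nr; apply: nq; exists q; split=> // r qrI.
  by apply: contrapT => qr0; apply: nr; exists r.
have xq0 : (q : conv_ring R) *: x <> 0.
  move=> xq; apply: q0; rewrite -[q]mulr1; apply: qI; rewrite mulr1.
  exact/mk_submodP.
have [r [xqr0 /mk_submodP[s' s'E]]] := essentialE essI xq0.
have s'0 : s' <> 0 by move=> s'0; apply: xqr0; rewrite s'E s'0 linear0.
have [t tE] := simple_gen (Sub s (cyclic_sub_refl s)) (simple_elt_cyclic_sub
  gs) s'0.
pose b := q * (r : R) * (t : R).
have xb : (b : conv_ring R) *: x = w by rewrite /b !scaleM s'E -linearZ /w tE.
have bM (m : R) : e * m \in @jacobson R -> b * m = 0.
  move=> emJ; rewrite /b -!mulrA; apply: qI; rewrite !mulrA -/b.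
  by apply/mk_submodP; rewrite scaleM xb wr.
exists b; split.
- by move=> b0; apply: w0; rewrite -xb b0 scale0r.
- apply/eqP; rewrite eq_sym -subr_eq0 -{1}[b]mulr1 -mulrBr bM //.
  by rewrite mulrBr mulr1 ee subrr rpred0.
- by move=> j jJ; apply/bM/jacobsonMl.
Qed.

End UnmixedTops.

(** * Socles and annihilators *)

Notation simpleR a := (simple_elt (a : right_reg _)).
Notation simpleL a := (simple_elt (a : left_reg _)).

Section SocleElements.
Variable R : pzRingType.
Hypothesis injR : injective_mod (right_reg R).
Implicit Types (a b x y r : R).

Lemma simpleR_inv a r : simpleR a -> a * r <> 0 -> exists s, a * r * s = a.
Proof. by move=> [_ sa] /sa[s]; exists s. Qed.

Lemma simpleL_inv a r : simpleL a -> r * a <> 0 -> exists s, s * (r * a) = a.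
Proof. by move=> [_ sa] /sa[s]; exists s. Qed.

Lemma simpleR_of a : a <> 0 -> (forall r, a * r <> 0 ->
  exists s, a * r * s = a) ->
  simpleR a.
Proof. by move=> a0 sa; split=> // r /sa[s]; exists s. Qed.

Lemma simpleL_of a : a <> 0 -> (forall r, r * a <> 0 ->
  exists s, s * (r * a) = a) ->
  simpleL a.
Proof. by move=> a0 sa; split=> // r /sa[s]; exists s. Qed.

Lemma simpleR_kills a : simpleR a -> kills_jacobson a.
Proof.
move=> sa j jJ; apply: contrapT => /(simpleR_inv sa)[s ajs].
have [a0 _] := sa; apply/a0/(@jacobson_fixr R a (j * s));
  first exact: jacobsonMr.
by rewrite mulrA ajs.
Qed.

Lemma top_simpleR e a : local_elt e -> a <> 0 -> a * e = a ->
  kills_jacobson a -> simpleR a.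
Proof.
move=> loce a0 ae aJ;
  apply: simpleR_of => // x /(top_right_inv loce ae aJ)[r exr].
by exists r; rewrite -[RHS]ae -exr !mulrA ae.
Qed.

Lemma simpleR_mull r a : simpleR a -> r * a <> 0 -> simpleR (r * a).
Proof.
move=> sa ra0; apply: simpleR_of => // x rax.
have [|s axs] := @simpleR_inv a x sa.
  by move=> ax; apply: rax; rewrite -mulrA ax mulr0.
by exists s; rewrite -[in RHS]axs !mulrA.
Qed.

Lemma simpleL_of_simpleR a : simpleR a -> simpleL a.
Proof.
move=> sa; have [a0 _] := sa; apply: simpleL_of => // r ra0.
apply: baer_ann => // x rax; apply: contrapT => /(simpleR_inv sa)[s axs].
by apply: ra0; rewrite -axs !mulrA rax mul0r.
Qed.

End SocleElements.

Section PseudoFrobenius.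
Variable R : pzRingType.
Hypothesis injR : injective_mod (right_reg R).
Hypothesis duoR : essentially_right_duo R.
Hypothesis hypR : right_hypersimple R.
Variables (T : finType) (e : T -> R).
Hypothesis e_local : forall i, local_elt (e i).
Hypothesis e_orth : forall i j, i != j -> e i * e j = 0.
Hypothesis e_sum : \sum_i e i = 1.
Implicit Types (a b x y r : R) (I : submodClosed (right_reg R)).

Let ee i : e i * e i = e i. Proof. by case: (e_local i). Qed.
Let e0 i : e i <> 0. Proof. by case: (e_local i). Qed.

Lemma top_embeds_all i : top_embeds (e i).
Proof.
case: (pselect (mixed (e i))) => [mi|nmi].
  exact: (mixed_top_embeds injR duoR e_local e_orth e_sum).
exact: unmixed_top_embeds.
Qed.

(** The embedded copy of the top of e_i R can be found inside e_i R: a nonzero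
    component of it in e_j R with j <> i would make e_j mixed, and then e_i as
    well. *)
Lemma unmixed_self i : ~ mixed (e i) ->
  exists a, [/\ e i * a <> 0 & kills_jacobson a].
Proof.
move=> ni; have [a [a0 ae aJ]] := top_embeds_all i; exists a; split=> //.
have [j ja0] := nonzero_comp_l e_sum a0.
have [<- //|ji] := eqVneq j i.
have mj : mixed (e j).
  exists (a * e i); rewrite mulrBr mulr1 -(mulrA (e j)) -(mulrA a) (e_orth (i
    := i)).
    by rewrite !mulr0 subr0 ae.
  by rewrite eq_sym.
case: ni; apply: (top_in_mixed injR duoR e_local e_orth mj).
exists (e j * a); split=> //; first by rewrite mulrA ee.
  by rewrite -mulrA ae.
exact: kills_jacobsonMl.
Qed.

Lemma comp_kills i b : e i * b <> 0 ->
  exists r, e i * b * r <> 0 /\ kills_jacobson (e i * b * r).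
Proof.
move=> ib0; case: (pselect (mixed (e i))) => [[r u0]|ni].
  have [s uE] := duo_minimal injR duoR r (e_local i) ib0.
  by exists s; rewrite -uE; split=> //; apply: mixed_kills.
have [a [ia0 aJ]] := unmixed_self ni.
have [r [s [rs r0]]] := uniform_of_local injR (e_local i) ib0 ia0.
exists r; split=> //; rewrite rs.
exact/kills_jacobsonMr/kills_jacobsonMl.
Qed.

(** Right multiples bring the components e_i b, one after the other, into the
    left annihilator of J. *)
Lemma right_socle_dense : socle_dense (right_reg R).
Proof.
move=> b b0.
suff [r [br0 brJ]] : exists r : R, (b : R) * r <> 0 /\
  kills_jacobson ((b : R) * r).
  have [k brk0] := nonzero_comp_r e_sum br0; exists (r * e k).
  have -> : (r * e k : conv_ring R) *: b = (b : R) * r * e k.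
    by rewrite -mulrA.
  apply: (@top_simpleR R (e k)) => //; first by rewrite -mulrA ee.
  exact: kills_jacobsonMr.
have [r [br0 brJ]] : exists r : R, (b : R) * r <> 0 /\
    forall i, i \in enum T -> kills_jacobson (e i * ((b : R) * r)).
  elim: (enum T) => [|i s [r [br0 brJ]]]; first by exists 1; rewrite mulr1.
  case: (pselect (e i * ((b : R) * r) = 0)) => [ibr|/comp_kills[t [ibrt
    ibrtJ]]].
    exists r; split=> // j; rewrite inE => /orP[/eqP -> l _|/brJ //].
    by rewrite ibr mul0r.
  exists (r * t); split.
    by move=> brt; apply: ibrt; rewrite -!mulrA brt mulr0.
  move=> j; rewrite inE => /orP[/eqP ->|/brJ jJ];
    first by rewrite !mulrA in ibrtJ *.
  rewrite !mulrA; apply: kills_jacobsonMr; by rewrite mulrA in jJ.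
exists r; split=> // j jJ; rewrite -[LHS]mul1r -e_sum mulr_suml big1 // => i _.
by rewrite mulrA brJ ?mem_enum.
Qed.

(** R/M embeds in R for every maximal right ideal M containing I, because it is
    isomorphic to the top of e_k R as soon as e_k is not in M. *)
Lemma proper_killed I : (1 : right_reg R) \notin I ->
  exists s : R, simpleR s /\ forall t : R, (t : right_reg R) \in I -> s * t = 0.
Proof.
move=> /proper_in_maximal[M maxM IM].
have [k kM] : exists k, (e k : right_reg R) \notin M.
  apply: contrapT => nk; case/negP: (maximal_proper maxM).
  have -> : (1 : right_reg R) = \sum_k (e k : right_reg R) := esym e_sum.
  apply: rpred_sum => k _.
  by apply/negPn/negP => kM; apply: nk; exists k.
have [a [a0 ae aJ]] := top_embeds_all k.
have [r [m [mM E]]] := maximal_comaximal maxM kM.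
have tJ t : (e k * r * t : right_reg R) \in M -> e k * r * t \in @jacobson R.
  move=> tM; apply: contrapT => /negP; rewrite -mulrA => tJ.
  have [x kx] := local_elt_right_inv (e_local k) tJ.
  by case/negP: kM; rewrite -kx; apply: right_idealM; rewrite mulrA.
have sa : simpleR a := top_simpleR (e_local k) a0 ae aJ.
exists (a * r); split; last first.
  move=> t /IM tM; rewrite -ae -2!mulrA [e k * _]mulrA; apply/aJ/tJ.
  have tE : m * t + e k * r * t = t by rewrite -mulrDl -E mul1r.
  have -> : e k * r * t = t - m * t by rewrite -[X in X - _]tE addrC addKr.
  exact/submodB/right_idealM.
apply: simpleR_of => [ar0|x arx].
  case/negP: (maximal_proper maxM); rewrite [X in X \in M]E;
    apply: rpredD => //.
  have [rJ|rJ] := boolP (e k * r \in @jacobson R).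
    by move/asboolP: rJ => /(_ M maxM).
  have [x kx] := local_elt_right_inv (e_local k) rJ.
  by case: a0; rewrite -ae -kx !mulrA ae ar0 mul0r.
have [|y aE] := @simpleR_inv R a (r * x) sa; first by rewrite mulrA.
by exists (y * r); rewrite -[in RHS]aE !mulrA.
Qed.

(** A nonzero map from (xR + I)/I to R is induced by a left multiplication. *)
Lemma double_annihilator I x : (x : right_reg R) \notin I ->
  exists c : R, (forall t : R, (t : right_reg R) \in I -> c * t = 0) /\
    c * x <> 0.
Proof.
move=> xI.
have colP : submod_axiom (V :=
  right_reg R) (fun r : R => (x * r : right_reg R) \in I).
  apply: right_ideal_axiom; first by rewrite mulr0 rpred0.
    by move=> y z; rewrite mulrDr; apply: rpredD.
  by move=> y z; rewrite mulrA; apply: right_idealM.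
have [|s [ss sP]] := @proper_killed (mk_submod colP).
  by apply: contra xI => /mk_submodP; rewrite mulr1.
have {}sP t : (x * t : right_reg R) \in I -> s * t = 0.
  by move=> xt; apply/sP/mk_submodP.
have [|y z y' z' [t [r [tI -> ->]]] [t' [r' [t'I -> ->]]]
      |y z a [t [r [tI -> ->]]]|z [t [r [tI txr ->]]]|c cP] :=
  @left_mult_extend R injR (fun y z => exists t r : R,
     [/\ (t : right_reg R) \in I, y = t + x * r & z = s * r]).
- by exists 0, 0; rewrite !mulr0 addr0 rpred0.
- exists (t + t'), (r + r'); split; [exact: rpredD| |by rewrite mulrDr].
  by rewrite mulrDr addrACA.
- exists (t * a), (r * a); split; [exact: right_idealM| |by rewrite mulrA].
  by rewrite mulrDl mulrA.
- apply: sP; have -> : x * r = - t by apply/eqP; rewrite -addr_eq0 addrC -txr.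
  exact: (@submodN _ (right_reg R)).
exists c; split=> [t tI|].
  by apply: cP; exists t, 0; rewrite !mulr0 addr0.
have -> : c * x = s; last by case: ss.
by apply: cP; exists 0, 1; rewrite !mulr1 add0r rpred0.
Qed.

(** If a is not in arR, some c kills ar but not a; as Ra is simple, a is in Rca
    and so ar = 0. *)
Lemma simpleR_of_simpleL a : simpleL a -> simpleR a.
Proof.
move=> sa; have [a0 _] := sa; apply: simpleR_of => // r ar0.
have [/eR_P[s aE]|na] :=
  boolP ((a : right_reg R) \in cyclic_sub (a * r : right_reg R)).
  by exists s.
have [c [cI ca0]] := double_annihilator na.
have [d dca] := simpleL_inv sa ca0.
by case: ar0; rewrite -dca -!mulrA cI ?mulr0 ?cyclic_sub_refl.
Qed.

(** An element s with sR simple that kills r(b) is a left multiple of b. *)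
Lemma left_socle_dense : socle_dense (left_reg R).
Proof.
move=> b b0.
have annP : submod_axiom (V := right_reg R) (fun r : R => (b : R) * r = 0).
  apply: right_ideal_axiom; first by rewrite mulr0.
    by move=> y z by0 bz0; rewrite mulrDr by0 bz0 addr0.
  by move=> y z by0; rewrite mulrA by0 mul0r.
have [|s [ss sP]] := @proper_killed (mk_submod annP).
  by apply/negP => /mk_submodP; rewrite mulr1.
have [r br|c cb] := @baer_ann R injR (b : R) s; first exact/sP/mk_submodP.
exists c; have -> : c *: b = s := cb; exact: simpleL_of_simpleR.
Qed.

Lemma right_socleP x :
  (x : right_reg R) \in socle (right_reg R) <-> kills_jacobson x.
Proof.
split=> [/socleP[s sP ->] j jJ|xJ].
  elim: s sP => [|y s IH] sP; first by rewrite big_nil mul0r.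
  rewrite big_cons [LHS]mulrDl (simpleR_kills (sP _ (mem_head _ _))) // add0r.
  by apply: IH => z zs; apply: sP; rewrite inE zs orbT.
have -> : x = \sum_k (x * e k : right_reg R) by rewrite -[LHS]mulr1 -e_sum
  mulr_sumr.
apply: rpred_sum => k _; case: (pselect (x * e k = 0)) => [->|xk0].
  exact: rpred0.
apply: simple_elt_socle; apply: (top_simpleR (e_local k)) => //.
  by rewrite -mulrA ee.
exact: kills_jacobsonMr.
Qed.

Lemma left_socleP x :
  (x : left_reg R) \in socle (left_reg R) <-> kills_jacobson x.
Proof.
split=> [/socleP[s sP ->]|/right_socleP/socleP[s sP ->]].
  elim: s sP => [|y s IH] sP j jJ; first by rewrite big_nil mul0r.
  rewrite big_cons [LHS]mulrDl (simpleR_kills (simpleR_of_simpleL (sP _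
    (mem_head _ _)))) // add0r.
  by apply: IH => // z zs; apply: sP; rewrite inE zs orbT.
apply/socleP; exists s => // y /sP; exact: simpleL_of_simpleR.
Qed.

End PseudoFrobenius.

Lemma socle_dense_submod (A : pzRingType) (V : lmodType A) (U : submodClosed V)
  :
  socle_dense V -> socle_dense (submod U).
Proof.
move=> dV x x0; have [|a ax] := dV (val x).
  by move=> vx; apply: x0; apply: val_inj.
by exists a; apply/simple_elt_submod; rewrite linearZ.
Qed.

(** A right ideal of the corner generated by an element outside its maximal
    right ideal is everything.  For X in that maximal right ideal, and any r,
    the corner inverse of e - X (e r e) gives a right inverse of 1 - X r, so
    that X is in J(R). *)
Lemma local_idempotent_elt (R : pzRingType) (e : idem_elt R) :
  local_idempotent e -> local_elt (e : R).
Proof.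
move=> [M maxM uniqM]; have ee := idem_mul e.
have oneM := maximal_proper maxM.
have valE (c : corner_ring e) : (e : R) * val c = val c /\
  val c * (e : R) = val c.
  by have /asboolP[r ->] := valP c; rewrite !mulrA ee -!mulrA ee.
have inv (c : corner_ring e) : (c : right_reg (corner_ring e)) \notin M ->
    exists y : corner_ring e, val c * val y = (e : R).
  move=> cM; have [/eR_P[y cy]|n1] :=
      boolP ((1 : right_reg (corner_ring e)) \in cyclic_sub (c : right_reg
        (corner_ring e))).
    by exists y; apply: esym (congr1 val cy).
  have [M' maxM' cM'] := proper_in_maximal n1.
  by case/negP: cM; rewrite -(uniqM _ maxM'); apply/cM'/cyclic_sub_refl.
have cornP x : (e : R) * x * (e : R) \in @in_corner R e by apply/asboolP;
  exists x.
split=> //.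
  move=> e0; case/negP: oneM.
  have -> : (1 : right_reg (corner_ring e)) = 0 by apply: val_inj.
  exact: rpred0.
move=> x; pose c : corner_ring e := Sub ((e : R) * x * (e : R)) (cornP x).
have [cM|cM] := boolP ((c : right_reg (corner_ring e)) \in M); last first.
  have [y cy] := inv c cM; right; exists (val y).
  by rewrite (valE y).1 (valE y).2.
left; apply: jacobson_of_right_inv => r; set X := (e : R) * x * (e : R).
pose d : corner_ring e := Sub ((e : R) * r * (e : R)) (cornP r).
have [|v vE] := inv (1 - c * d).
  apply: contra oneM => ncd;
    rewrite -[X in X \in M](subrK (c * d : corner_ring e)).
  by apply: rpredD ncd _; apply: right_idealM.
have {}vE : ((e : R) - X * ((e : R) * r * (e : R))) * val v = (e : R) := vE.
have Xe : X * (e : R) = X by rewrite /X -(mulrA _ (e : R) (e : R)) ee.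
have eX : (e : R) * X = X by rewrite /X !mulrA ee. clearbody X.
have qv : (1 - X * r) * val v = (e : R).
  rewrite -[RHS]vE !mulrBl mul1r (valE v).1; congr (_ - _).
  by rewrite !mulrA Xe -(mulrA _ (e : R)) (valE v).1.
set g := 1 - (e : R); exists (val v + g + val v * X * r * g).
rewrite 2!mulrDr !mulrA qv eX mulrBl mul1r addrA subrK.
by rewrite /g addrC subrK.
Qed.

(** * Consequences *)

Section Conclusions.
Variable R : pzRingType.
Hypothesis injR : injective_mod (right_reg R).
Hypothesis duoR : essentially_right_duo R.
Hypothesis hypR : right_hypersimple R.
Variables (T : finType) (e : T -> R).
Hypothesis e_local : forall i, local_elt (e i).
Hypothesis e_orth : forall i j, i != j -> e i * e j = 0.
Hypothesis e_sum : \sum_i e i = 1.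
Implicit Types (a b x y r : R) (I : submodClosed (right_reg R)).

Let ee i : e i * e i = e i. Proof. by case: (e_local i). Qed.
Let e0 i : e i <> 0. Proof. by case: (e_local i). Qed.
Let denseR : socle_dense (right_reg R).
Proof. exact: (right_socle_dense injR duoR hypR e_local e_orth e_sum). Qed.
Let denseL : socle_dense (left_reg R).
Proof. exact: (left_socle_dense injR duoR hypR e_local e_orth e_sum). Qed.
Let leftR a : simpleL a -> simpleR a.
Proof. exact: (simpleR_of_simpleL injR duoR hypR e_local e_orth e_sum). Qed.
Let rightL a : simpleR a -> simpleL a.
Proof. exact: simpleL_of_simpleR. Qed.

Lemma uniform_simpleR f x y : local_elt f -> f * x <> 0 -> simpleR (f * y) ->
  exists r, f * x * r = f * y.
Proof.
move=> locf fx0 sy; have [fy0 _] := sy.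
have [r [s [rs fxr0]]] := uniform_of_local injR locf fx0 fy0.
have [|t tE] := @simpleR_inv R (f * y) s sy; first by rewrite -rs.
by exists (r * t); rewrite mulrA rs tE.
Qed.

Lemma right_simple_span : exists s : seq (right_reg R),
  (forall x : right_reg R, x \in s -> simple_elt x) /\
  (forall x : right_reg R, simple_elt x ->
    forall W : submodClosed (right_reg R),
     {subset s <= W} -> x \in W).
Proof.
have dense i : exists r : R, simpleR (e i * r).
  by have [r] := denseR (@e0 i : (e i : right_reg R) <> 0); exists r.
pose a i := projT1 (cid (dense i)).
have aP i : simpleR (e i * a i) by rewrite /a; case: cid.
exists [seq (e i * a i : right_reg R) | i <- enum T].
split=> [x /mapP[i _ ->] //|x sx W sW].
have xE : (x : R) = \sum_i e i * (x : R) by rewrite -mulr_suml e_sum mul1r.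
have -> : x = \sum_i (e i * (x : R) : right_reg R) := xE.
apply: rpred_sum => i _; case: (pselect (e i * (x : R) = 0)) => [->|ix0].
  exact: rpred0.
have [ia0 _] := aP i.
have [r <-] := uniform_simpleR (e_local i) ia0 (simpleR_mull sx ix0).
by apply: right_idealM; apply: sW; apply/mapP; exists i; rewrite ?mem_enum.
Qed.

Lemma left_simple_span : exists s : seq (left_reg R),
  (forall x : left_reg R, x \in s -> simple_elt x) /\
  (forall x : left_reg R, simple_elt x -> forall W : submodClosed (left_reg R),
     {subset s <= W} -> x \in W).
Proof.
have K i : top_embeds (e i) :=
  top_embeds_all injR duoR hypR e_local e_orth e_sum i.
pose a i := projT1 (cid (K i)).
have aP i : [/\ a i <> 0, a i * e i = a i & kills_jacobson (a i)].
  by rewrite /a; case: cid.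
exists [seq (a i : left_reg R) | i <- enum T].
split=> [x /mapP[i _ ->] //|x sx W sW].
  by have [a0 ae aJ] := aP i; apply/rightL/(top_simpleR (e_local i)).
have xE : (x : R) = \sum_i (x : R) * e i by rewrite -mulr_sumr e_sum mulr1.
have -> : x = \sum_i ((x : R) * e i : left_reg R) := xE.
apply: rpred_sum => i _; have [a0 ae aJ] := aP i.
have [||c <-] := @top_left_mult R injR (e i) (a i) ((x : R) * e i) (e_local i)
  a0 ae.
- by rewrite -mulrA ee.
- exact/kills_jacobsonMr/simpleR_kills/leftR.
by apply: (@rpredZ _ _ W c); apply: sW; apply/mapP; exists i; rewrite ?mem_enum.
Qed.

Lemma right_cogenerator : cogenerator_mod (right_reg R).
Proof.
move=> M N f g /existsNP[m fg].
pose n := f m - g m.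
have [|s [ss sn]] := @proper_killed R injR duoR hypR T e e_local e_orth e_sum
  (ann n).
  apply/negP => /mk_submodP; rewrite scale1r => n0; apply: fg.
  by apply/eqP; rewrite -subr_eq0; apply/eqP.
pose G (y : N) (z : right_reg R) :=
  exists r : R, y = (r : conv_ring R) *: n /\ z = s * r.
have GP : pairs_submod G.
  split; first by exists 0; rewrite scale0r mulr0.
    move=> y z y' z' [r [-> ->]] [r' [-> ->]]; exists (r + r').
    by rewrite scalerDl mulrDr.
  move=> a y z [r [-> ->]]; exists (r * (a : R)).
  by rewrite scalerA mulrA.
have [z [r [/esym rn ->]]|h hG] := injective_extend injR GP.
  by apply/sn/mk_submodP.
exists h => hfg; have [s0 _] := ss; apply: s0.
have <- : h n = s by apply: hG; exists 1; rewrite scale1r mulr1.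
by rewrite linearB; apply/eqP; rewrite subr_eq0; apply/eqP/hfg.
Qed.

(** An element with essential left annihilator is killed on the left by the
    socle, and the right annihilator of the socle is J since all tops occur in
    the socle. *)
Lemma left_singular_jacobson (z : R) :
  singular_mem (z : left_reg R) <-> z \in @jacobson R.
Proof.
split=> [sz|zJ]; last first.
  apply: essential_of => b /denseL[c sc]; exists c; split; first by case: sc.
  by apply/ann_leftP; apply: simpleR_kills zJ; apply: leftR.
have kill a : simpleL a -> a * z = 0.
  move=> sa; have [a0 _] := sa; have [r [ra0 /ann_leftP raz]] :=
    essentialE sz a0.
  have [s sra] := simpleL_inv sa ra0.
  by rewrite -sra -mulrA raz mulr0.
suff zk k : e k * z \in @jacobson R.
  by rewrite -[z]mul1r -e_sum mulr_suml; apply: rpred_sum => k _.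
apply: contrapT => /negP kz; have [r kzr] := local_elt_right_inv (e_local k) kz.
have [a [a0 ae aJ]] := top_embeds_all injR duoR hypR e_local e_orth e_sum k.
have sa : simpleL a := rightL (top_simpleR (e_local k) a0 ae aJ).
by apply: a0; rewrite -ae -kzr !mulrA ae kill ?mul0r.
Qed.

(** For y = e_i y nonzero in S and a = e_i a with Ra simple, the map
    t y |-> t a is well defined, as both Ry and Ra are the top of R e_i. *)
Lemma left_simple_embeds (S : lmodType R) : simple_mod S ->
  embeds S (left_reg R).
Proof.
move=> simS; have [[y0 /eqP y00] _] := simS.
have [i y0i] : exists i, e i *: y0 <> 0.
  apply: contrapT => ne; apply: y00.
  rewrite -[y0]scale1r -e_sum scaler_suml big1 // => i _.
  by apply: contrapT => yi; apply: ne; exists i.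
have [r sr] := denseR (@e0 i : (e i : right_reg R) <> 0).
pose a := e i * (r : R); have sa : simpleR a := sr.
set y := e i *: y0 in y0i.
have ya t : t *: y = 0 -> t * a = 0.
  move=> ty; apply: contrapT => ta0.
  have [s sta] := simpleL_inv (rightL sa) ta0.
  have ea : e i * a = a by rewrite /a mulrA ee.
  have [locJ|locN] := boolP (e i * (s * t) * e i \in @jacobson R).
    have [a0 _] := sa; apply/a0/(@jacobson_fixl R a (e i * (s * t) * e i)) =>
      //.
    by rewrite -mulrA ea -!mulrA sta ea.
  have [v vE] := local_elt_left_inv (e_local i) locN.
  apply: y0i; rewrite /y -vE -scalerA -scalerA -/y -!scalerA.
  by rewrite ty !scaler0.
pose G (z : S) (w : left_reg R) := exists t : R, z = t *: y /\ w = t * a.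
have [||z|f fG] := @linear_of_pairs R S (left_reg R) G.
- split; first by exists 0; rewrite scale0r mul0r.
    move=> z w z' w' [t [-> ->]] [t' [-> ->]]; exists (t + t').
    by rewrite scalerDl mulrDl.
  by move=> c z w [t [-> ->]]; exists (c * t); rewrite scalerA -mulrA.
- by move=> w [t [/esym ty ->]]; apply: ya.
- by have [t ->] := simple_gen z simS y0i; exists (t * a), t.
have f0 z : f z = 0 -> z = 0.
  move=> fz; apply: contrapT => z0; have [t yt] := simple_gen y simS z0.
  have [a0 _] := sa; apply: a0.
  have <- : f y = a by apply: fG; exists 1; rewrite scale1r mul1r.
  by rewrite yt linearZ /= fz scaler0.
exists f => z w fzw; apply/eqP; rewrite -subr_eq0; apply/eqP/f0.
by rewrite linearB fzw subrr.
Qed.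

Lemma right_simple_embeds (S : rmodType R) : simple_mod S ->
  embeds S (right_reg R).
Proof.
move=> simS; have [[y /eqP y0] _] := simS.
have [|h hid] := right_cogenerator (f := idfun : {linear S -> S}) (g :=
  \0 : {linear S -> S}).
  by move=> /(_ y).
have hy : h y <> 0.
  move=> hy; apply: hid => z /=; have [t ->] := simple_gen z simS y0.
  by rewrite !linearZ /= hy !linear0 scaler0.
exists h => z w hzw; apply/eqP; rewrite -subr_eq0; apply/eqP.
apply: contrapT => zw0; have [t yt] := simple_gen y simS zw0.
by apply: hy; rewrite yt linearZ linearB /= hzw subrr scaler0.
Qed.

(** Let K be a complement of I.  A map from a submodule of I to I is left
    multiplication by some c, which preserves the essential right ideal I + K;
    following it by the projection to I gives the extension. *)
Lemma right_q : right_q_ring R.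
Proof.
move=> I U f.
have [s [sP sW]] := right_simple_span.
have [K [IK sK]] := complement I sP.
have essT : essential (sum_sub I K).
  apply: essential_of => x /denseR[r sr]; exists r; split; first by case: sr.
  exact: sW.
have [|x y x' y' [u [-> ->]] [u' [-> ->]]|x y r [u [-> ->]]|y [u [u0 ->]]|c cP]
  :=
  @left_mult_extend R injR (fun x y : R => exists u : submod U,
     x = val (val u) /\ y = val (f u)).
- by exists 0; rewrite !linear0.
- by exists (u + u'); rewrite !linearD.
- by exists ((r : conv_ring R) *: u); rewrite !linearZ.
- suff -> : u = 0 by rewrite !linear0.
  by apply: val_inj; apply: val_inj.
pose G (x z : submod I) := (val z - (c * (val x : R) : R) : right_reg R) \in K.
have [|z|x|g gG] := @linear_of_pairs _ (submod I) (submod I) G.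
- split; rewrite /G.
  + by rewrite !linear0 mulr0 subrr rpred0.
  + move=> x y x' y' xy xy'; rewrite !linearD mulrDr opprD addrACA.
    exact: rpredD.
  + move=> a x y xy; have := rpredZ a xy; rewrite scalerBr.
    have -> : a *: (c * (val x : R) : right_reg R) = c * ((val x : R) * (a :
      R)).
      exact: esym (mulrA c (val x : R) (a : R)).
    by rewrite !linearZ.
- rewrite /G linear0 mulr0 subr0 => zK; apply: val_inj; apply: IK zK.
  exact: valP.
- have : (c * (val x : R) : right_reg R) \in sum_sub I K.
    by apply: duoR => //; apply/sum_subl/valP.
  move=> /sum_subP[i [k [iI kK cx]]]; exists (Sub i iI).
  by rewrite /G cx SubK opprD addrA subrr add0r; apply: submodN.
exists g => u; apply: gG; rewrite /G (cP _ (val (f u))); last by exists u.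
by rewrite subrr rpred0.
Qed.

Lemma local_socles (f : idem_elt R) : local_idempotent f ->
  [/\ simple_mod (submod (socle (eR_mod f))),
      simple_mod (submod (socle (Re_mod f))),
      essential (socle (eR_mod f)) & essential (socle (Re_mod f))].
Proof.
move=> /local_idempotent_elt locf; have [ff f0 _] := locf.
have dR : socle_dense (eR_mod f) by apply: socle_dense_submod.
have dL : socle_dense (Re_mod f) by apply: socle_dense_submod.
split; [| |exact: essential_socle|exact: essential_socle].
  apply: simple_socle => //.
    exists (Sub (f : R) (cyclic_sub_refl _)) => /(congr1 val); exact: f0.
  move=> x y /simple_elt_submod sx /simple_elt_submod sy.
  have /eR_P[x' xE] := valP x; have /eR_P[y' yE] := valP y.
  rewrite xE in sx; rewrite yE in sy; have [fx0 _] := sx.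
  have [r rE] := uniform_simpleR locf fx0 sy.
  by exists r; apply: val_inj; rewrite linearZ /= xE yE -rE.
apply: simple_socle => //.
  exists (Sub (f : R) (cyclic_sub_refl _)) => /(congr1 val); exact: f0.
move=> x y /simple_elt_submod sx /simple_elt_submod sy.
have /Re_P[x' xE] := valP x; have /Re_P[y' yE] := valP y.
rewrite xE in sx; rewrite yE in sy; have [fx0 _] := sx.
have [|||c cE] := @top_left_mult R injR (f : R) (x' * (f : R)) (y' * (f : R))
  locf fx0.
- by rewrite -mulrA ff.
- by rewrite -mulrA ff.
- exact/simpleR_kills/leftR.
by exists c; apply: val_inj; rewrite linearZ /= xE yE -cE.
Qed.

End Conclusions.

Theorem theorem2p16 (R : pzRingType) :
  semilocal R -> right_hypersimple R -> essentially_right_duo R ->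
  cyclic_hull (right_reg R) ->
  right_PF R /\
  (* (1) *)
  ((forall x : R, x \in @jacobson R <-> singular_mem (x : right_reg R)) /\
   (forall x : R, x \in @jacobson R <-> singular_mem (x : left_reg R))) /\
  (* (2) *)
  (forall x : R, (x : right_reg R) \in socle (right_reg R) <->
                 (x : left_reg R) \in socle (left_reg R)) /\
  (* (3) *)
  (essential (socle (right_reg R)) /\ essential (socle (left_reg R))) /\
  (* (4) *)
  (forall e : idem_elt R, local_idempotent e ->
     [/\ simple_mod (submod (socle (eR_mod e))),
         simple_mod (submod (socle (Re_mod e))),
         essential (socle (eR_mod e)) &
         essential (socle (Re_mod e))]) /\
  (* (5) *)
  (finite_goldie (left_reg R) /\ finite_goldie (right_reg R)) /\
  (* (6) *)
  ((forall S : rmodType R, simple_mod S -> embeds S (right_reg R)) /\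
   (forall S : lmodType R, simple_mod S -> embeds S (left_reg R))) /\
  (* (7) *)
  right_q_ring R /\
  (* (8) *)
  (forall (T : submodClosed (right_reg R)) (x : R),
     (x : right_reg R) \in T <->
     right_ann (left_ann (fun t : R => (t : right_reg R) \in T)) x).
Proof.
move=> semR hypR duoR cycR.
have injR := self_injective_of_cyclic_hull semR cycR.
have [T [e [e_local e_orth e_sum]]] := decomposition injR semR.
have rsocP := right_socleP e_local e_sum.
have lsocP := left_socleP injR duoR hypR e_local e_orth e_sum.
have denseR := right_socle_dense injR duoR hypR e_local e_orth e_sum.
have denseL := left_socle_dense injR duoR hypR e_local e_orth e_sum.
have [s [sP sW]] := right_simple_span injR duoR hypR e_local e_orth e_sum.
have [t [tP tW]] := left_simple_span injR duoR hypR e_local e_orth e_sum.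
have cogR := right_cogenerator injR duoR hypR e_local e_orth e_sum.
split; first by [].
split.
  split=> x; first by split=> /(right_singular_jacobson injR).
  by split=> /(left_singular_jacobson injR duoR hypR e_local e_orth e_sum).
split; first by move=> x; rewrite rsocP lsocP.
split; first by split; apply: essential_socle.
split; first exact: (local_socles injR duoR hypR e_local e_orth e_sum).
split; first by split; [exact: finite_goldie_of tW|exact: finite_goldie_of sW].
split.
  split=> S; first exact: (right_simple_embeds injR duoR hypR e_local e_orth
    e_sum).
  exact: (left_simple_embeds injR duoR hypR e_local e_orth e_sum).
split; first exact: (right_q injR duoR hypR e_local e_orth e_sum).
move=> I x; split=> [xI c cI|xann]; first exact: cI.
apply/negPn/negP => /(double_annihilator injR duoR hypR e_local e_orth e_sum).
by move=> [c [cI]]; apply; apply: xann.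
Qed.
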